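(* Let $T$ be a transient tree with root $x_0$. Assume that $A,M,\delta>0$ are such that for large $n$ and all $x\in T^\infty$ with $|x|=n$, $$\sum_{y\in(x_0,x)}1\{R^\infty_y\le A,\ d_{y^-}\le M\}\ge\delta n.$$ Then there exists $\kappa(A,M,\delta)>0$ such that for large $n$ and all $x\in T^\infty$ with $|x|=n$, $$\mathbb P^G\big[x_0\stackrel{\varphi\ge0}{\longleftrightarrow}x\big]\le 2e^{-\kappa n}.$$
   Context: $T$ is a locally finite tree (locally finite connected graph without loops) with root $x_0$; each edge has unit weight and the corresponding weighted graph is transient. $d(\cdot,\cdot)$ is the graph distance and $|x|=d(x,x_0)$. $[x,y]$ is the set of sites on the geodesic path from $x$ to $y$; $(x,y)$ excludes both endpoints. For $x\ne x_0$, $x^-$ is the parent of $x$ (last site before $x$ on the geodesic from $x_0$ to $x$). $d_x=|\{y\in T;\ y^-=x\}|$ is the number of children of $x$. $T_x$ is the sub-tree of those $y\in T$ with $x\in[x_0,y]$. $T^\infty=\{x\in T;\ |T_x|=\infty\}$. $R^\infty_x\in(0,\infty]$ is the effective resistance between $x$ and infinity in $T_x$ (unit conductances): $R_x^\infty=\infty$ if $T_x$ is finite, and otherwise it is the non-decreasing limit in $N$ of the effective resistance in $T_x$ between $x$ and $\{x'\in T_x;\ d(x,x')=N\}$. Simple random walk $(X_k)_{k\ge0}$ on $T$ started at $x$ has expectation $E_x$; ${\rm deg}(x)$ is the degree of $x$. The Green function is $g(x,y)=\frac{1}{{\rm deg}(y)}E_x[\sum_{k\ge0}1\{X_k=y\}]$.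 Under $\mathbb P^G$, $(\varphi_x)_{x\in T}$ is the Gaussian free field: a centered Gaussian field with covariance $g(\cdot,\cdot)$. The event $\{x_0\stackrel{\varphi\ge0}{\longleftrightarrow}x\}$ means that $x_0$ and $x$ are connected by a path in $\{y\in T;\varphi_y\ge0\}$, i.e. $\varphi_y\ge0$ for all $y\in[x_0,x]$. *)

(* Defs.v *)
From HB Require Import structures.
From mathcomp Require Import all_boot all_order all_algebra finmap.
From mathcomp Require Import all_classical all_reals all_analysis.

Set Implicit Arguments.
Unset Strict Implicit.
Unset Printing Implicit Defensive.

Import Order.TTheory GRing.Theory Num.Theory.
Import numFieldNormedType.Exports.

Local Open Scope classical_set_scope.
Local Open Scope ring_scope.

(* Local finiteness is built in: the neighbours of a vertex form a finite set.
   In [tree_acyclic], [size s > 2] excludes the degenerate cycle x, y, x. *)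
Record rooted_tree : Type := RootedTree {
  vertex :> choiceType;
  nbrs : vertex -> {fset vertex};
  tree_root : vertex;
  tree_sym : forall x y, (y \in nbrs x) = (x \in nbrs y);
  tree_irrefl : forall x, x \notin nbrs x;
  tree_connected : forall x y, exists p : seq vertex,
    path (fun u v => v \in nbrs u) x p /\ last x p = y;
  tree_acyclic : forall s : seq vertex, (2 < size s)%N -> uniq s ->
    ~~ cycle (fun u v => v \in nbrs u) s }.

Section Tree.
Variable T : rooted_tree.
Implicit Types (x y z : T) (p : seq T).

Definition adj x y : bool := y \in nbrs x.

Definition deg x : nat := #|` nbrs x|%fset.

(* As in [path], a path is given by its starting point x and the sequence p of
   the vertices that follow, so that its length is [size p]. *)
Definition path_between x y p : Prop := path adj x p /\ last x p = y.

Lemma exists_path_size x y :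
  exists n, `[< exists2 p, path_between x y p & size p = n >].
Proof.
by have [p xpy] := tree_connected x y; exists (size p); apply/asboolP; exists p.
Qed.

Definition dist x y : nat := ex_minn (exists_path_size x y).

Definition height x : nat := dist x (tree_root T).

Definition geodesic x y p : Prop := path_between x y p /\ size p = dist x y.

Definition cseg x y : set T :=
  [set z | exists2 p, geodesic x y p & z \in x :: p].

Definition oseg x y : set T := [set z | [/\ cseg x y z, z <> x & z <> y]].

(* The value at the root, which has no parent, is the default [tree_root T]. *)
Definition parent x : T :=
  xget (tree_root T)
    [set z | exists2 p, geodesic (tree_root T) x (rcons p x) &
                        last (tree_root T) p = z].

(* [y <> tree_root T] discards the default value of [parent]. *)
Definition nchildren x : nat :=
  #|` fset_set [set y : T | y <> tree_root T /\ parent y = x]|%fset.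

Definition subtree x : set T := [set y | cseg (tree_root T) y x].

Definition Tinfty : set T := [set x | infinite_set (subtree x)].

End Tree.

Section Resistance.
Variables (R : realType) (T : rooted_tree).
Implicit Types (S A B : set T) (f : T -> R).
Local Open Scope ereal_scope.

(* Energy in the subgraph induced on S; every edge occurs in the sum with its
   two orientations, hence the factor 1/2. *)
Definition energy S f : \bar R :=
  (2^-1)%:E * \esum_(e in [set e : T * T | [/\ S e.1, S e.2 & adj e.1 e.2]])
                ((f e.1 - f e.2) ^+ 2)%:E.

(* Effective conductance, as given by Dirichlet's principle. *)
Definition Ceff S A B : \bar R :=
  ereal_inf [set energy S f | f in
    [set f : T -> R | (forall a, A a -> f a = 1%R) /\
                      (forall b, B b -> f b = 0%R)]].

(* Here [0^-1 = +oo]. *)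
Definition Reff S A B : \bar R := (Ceff S A B)^-1.

Definition Rinfty (x : T) : \bar R :=
  if `[< finite_set (subtree x) >] then +oo
  else limn (fun N : nat =>
    Reff (subtree x) [set x] [set y | subtree x y /\ dist x y = N]).

End Resistance.

Section RandomWalk.
Variables (R : realType) (T : rooted_tree).
Variables (d : measure_display) (W : measurableType d).
Variables (P : T -> probability W R) (X : nat -> W -> T).

Definition step (x y : T) : R := (adj x y)%:R / (deg x)%:R.

(* [P x] is the law of the walk started at x: T carries the discrete
   sigma-algebra, and the finite-dimensional marginals are those of the Markov
   chain with initial state x and transition matrix [step]. *)
Record simple_random_walk : Prop := SimpleRandomWalk {
  srw_measurable : forall k y, measurable (X k @^-1` [set y]);
  srw_law : forall x n (y : nat -> T),
    P x [set w | forall k, (k <= n)%N -> X k w = y k] =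
    ((y 0%N == x)%:R * \prod_(k < n) step (y k) (y k.+1))%:E }.

Definition transient : Prop :=
  forall x, (P x [set w | exists2 k, (0 < k)%N & X k w = x] < 1)%E.

Definition green (x y : T) : \bar R :=
  (((deg y)%:R^-1)%:E *
    \int[P x]_w \sum_(0 <= k <oo) ((X k w == y)%:R)%:E)%E.

End RandomWalk.

Section GaussianField.
Variables (R : realType) (T : rooted_tree).
Variables (d : measure_display) (Omega : measurableType d).
Variables (P : probability Omega R) (phi : T -> {RV P >-> R}).

(* Dirac masses are the degenerate Gaussian laws; they are listed separately
   because [normal_prob m 0] is by convention a uniform law. *)
Definition gaussian_law (mu : set R -> \bar R) : Prop :=
  (exists m : R, forall B : set R, measurable B -> mu B = \d_m B) \/
  (exists m s : R, 0 < s /\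
    forall B : set R, measurable B -> mu B = normal_prob m s B).

Record gaussian_free_field (g : T -> T -> \bar R) : Prop := GaussianFreeField {
  gff_gaussian : forall (s : seq T) (c : T -> R),
    gaussian_law
      (fun B => P ((fun w => \sum_(x <- s) c x * phi x w) @^-1` B));
  gff_centered : forall x, ('E_P[phi x] = 0)%E;
  gff_covariance : forall x y, covariance P (phi x) (phi y) = g x y }.

Definition connected_nonneg (x y : T) : set Omega :=
  [set w | exists2 p, path_between x y p &
                      forall z, z \in x :: p -> 0 <= phi z w].

End GaussianField.

Section GoodSites.
Variables (R : realType) (T : rooted_tree).

Definition good (A M : R) : set T :=
  [set y | (Rinfty R y <= A%:E)%E /\ (nchildren (parent y))%:R <= M].

End GoodSites.

(* Main.v *)
Require Import Defs.
From mathcomp Require Import all_boot all_order all_algebra finmap.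
From mathcomp Require Import all_classical all_reals all_analysis measurable_realfun.
From mathcomp Require Import ring lra.

(* Along the geodesic from the root to x the field is a Gaussian Markov chain,
   because g(x, z) g(y, y) = g(x, y) g(y, z) whenever y separates x from z.  For
   y with parent p the Green function satisfies
     g(p, p) g(y, y) = g(p, y) (1 + g(p, y)),
   so the squared correlation of phi_p and phi_y is g(p, y) / (1 + g(p, y)), and
   g(p, y) <= g(y, y) <= R_y^infty: test Dirichlet's principle with the expected
   number of visits to y before a fixed time, which has finite support.
   Hence consecutive good sites have squared correlation at most A / (1 + A),
   and every L-th good site gives a Markov chain Z_1, ..., Z_m of standard
   Gaussians with tiny consecutive correlations, m being about delta n / L.

   Take u = e^{tz} with t^2 = 1/10 and f(z) = 1 + (u - 1)(u - 3)^2 / 9, so that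
   f >= 0 everywhere, f >= 1 on [0, +oo[, and E[f(Z)] < 1.  Then the probability
   that all Z_i are nonnegative is at most E[f(Z_1) ... f(Z_m)].  Since f is a
   combination of exponentials, the quantities
     H_i(a) = E[f(Z_1) ... f(Z_i) e^{a Z_i}]
   obey an explicit recursion that only needs E[e^Y] = e^{Var(Y)/2} for linear
   combinations Y of the Z_i.  As f >= 0, H_i is convex in a, and this keeps
   H_i(-t), H_i(t) <= 2 H_i(0) under the recursion, which makes H_i(0) decay
   geometrically when the correlations are small. *)

Set Implicit Arguments.
Unset Strict Implicit.
Unset Printing Implicit Defensive.

Import Order.TTheory GRing.Theory Num.Theory.
Import numFieldNormedType.Exports.

Local Open Scope classical_set_scope.
Local Open Scope ring_scope.

(** * Random walk and Green function *)

Section WalkPaths.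
Variables (R : realType) (T : rooted_tree).
Variables (d : measure_display) (W : measurableType d).
Variables (Px : T -> probability W R) (X : nat -> W -> T).
Hypothesis srw : simple_random_walk Px X.
Hypothesis deg_gt0 : forall x : T, (0 < deg x)%N.

Local Notation step := (@step R T).

Fixpoint ptrans (k : nat) (x z : T) : R :=
  if k is k'.+1 then \sum_(v <- nbrs x) step x v * ptrans k' v z
  else (x == z)%:R.

Lemma step_ge0 (x y : T) : 0 <= step x y.
Proof. by rewrite /Defs.step divr_ge0. Qed.

Lemma step_nbr (x v : T) : v \in nbrs x -> step x v = (deg x)%:R^-1.
Proof. by rewrite /Defs.step /adj => ->; rewrite mul1r. Qed.

Lemma sum_step (x : T) : \sum_(v <- nbrs x) step x v = 1.
Proof.
rewrite big_seq (eq_bigr (fun=> (deg x)%:R^-1)) => [|v /step_nbr//].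
rewrite -big_seq big_const_seq count_predT iter_addr_0 -[RHS](@mulVf _ (deg x)%:R).
  by rewrite mulr_natr.
by rewrite pnatr_eq0 -lt0n.
Qed.

Lemma ptrans_ge0 k x z : 0 <= ptrans k x z.
Proof.
elim: k x => [|k IH] x /=; first by rewrite ler0n.
by apply: sumr_ge0 => v _; rewrite mulr_ge0 ?step_ge0.
Qed.

Let cyl n (y : nat -> T) : set W := [set w | forall k, (k <= n)%N -> X k w = y k].

Let pr (x : T) n (y : nat -> T) : R :=
  (y 0%N == x)%:R * \prod_(k < n) step (y k) (y k.+1).

Let ext n (y : nat -> T) (v : T) (k : nat) : T := if (k <= n)%N then y k else v.

Let pr_ext x n y v : pr x n.+1 (ext n y v) = pr x n y * step (y n) v.
Proof.
rewrite /pr big_ord_recr /= /ext leq0n leqnn ltnn mulrA; congr (_ * _ * _).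
by apply: eq_bigr => i _; rewrite (ltnW (ltn_ord i)) ltn_ord.
Qed.

Let mcyl n y : measurable (cyl n y).
Proof.
rewrite (_ : cyl n y = \bigcap_(k in `I_n.+1) (X k @^-1` [set y k])).
  by apply: fin_bigcap_measurable => // k _; apply: (srw_measurable srw).
by apply/seteqP; split=> w /= h k; apply: h.
Qed.

Let pcyl x n y : Px x (cyl n y) = (pr x n y)%:E := srw_law srw x n y.

Let cyl_ext n y v w : cyl n.+1 (ext n y v) w <-> cyl n y w /\ X n.+1 w = v.
Proof.
split=> [h|[h hv] k].
  split=> [k kn|]; first by rewrite h ?(leqW kn)// /ext kn.
  by rewrite h// /ext ltnn.
rewrite leq_eqVlt => /orP[/eqP->|]; first by rewrite /ext ltnn.
by rewrite ltnS => kn; rewrite /ext kn h.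
Qed.

Let cylU n y v1 v2 w : cyl n.+1 (ext n y v1) w -> cyl n.+1 (ext n y v2) w -> v1 = v2.
Proof. by move=> /cyl_ext[_ <-] /cyl_ext[_ <-]. Qed.

Let sum_nbrs (x : T) (F : T -> R) :
  (\sum_(v \in [set` nbrs x]) (F v)%:E = (\sum_(v <- nbrs x) F v)%:E)%E.
Proof. by rewrite fsbig_finite// set_fsetK -sumEFin. Qed.

Let cyl_hit x n y m z : Px x (cyl n y `&` X (n + m)%N @^-1` [set z]) =
  (pr x n y * ptrans m (y n) z)%:E.
Proof.
elim: m n y => [|m IH] n y.
  rewrite addn0 /=; have [<-|yz] := eqVneq (y n) z.
    rewrite mulr1 -pcyl; congr (Px x _).
    by apply/seteqP; split=> [w []//|w h]; split=> //=; apply: h.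
  rewrite mulr0 (_ : _ `&` _ = set0) ?measure0//.
  by apply/seteqP; split=> w //= [h hz]; move/eqP: yz; rewrite -(h n) // hz.
set E := _ `&` _.
have mE : measurable E.
  by apply: measurableI; [exact: mcyl|exact: (srw_measurable srw)].
pose U := \bigcup_(v in [set` nbrs (y n)]) cyl n.+1 (ext n y v).
have mU : measurable U.
  by apply: fin_bigcup_measurable => // v _; apply: mcyl.
have UC : U `<=` cyl n y by move=> w [v _] /cyl_ext[].
have PU : Px x U = (pr x n y)%:E.
  rewrite measure_fin_bigcup//; last first.
    by move=> v1 v2 _ _ [w [h1 h2]]; exact: cylU h1 h2.
  rewrite (eq_fsbigr (fun v => (pr x n y * step (y n) v)%:E)) => [|v _]; last first.
    by apply: etrans (pcyl _ _ _) _; rewrite pr_ext.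
  by rewrite sum_nbrs -mulr_sumr sum_step mulr1.
have -> : Px x E = Px x (E `&` U).
  rewrite [LHS](measureDI _ mE mU) [X in (X + _)%E](_ : _ = 0%E) ?add0e//.
  apply/eqP; rewrite eq_le measure_ge0 andbT.
  have -> : 0%E = Px x (cyl n y `\` U).
    rewrite measureD//; first last.
      by rewrite (le_lt_trans (probability_le1 _ _)) ?ltry.
    rewrite (setIidr UC) -(subee (x := (pr x n y)%:E))//.
    by congr (_ - _)%E; apply/esym; [exact: pcyl|exact: PU].
  apply: le_measure; rewrite ?inE; try exact: measurableD.
  by move=> w [[? _] ?]; split.
have -> : E `&` U = \bigcup_(v in [set` nbrs (y n)])
    (cyl n.+1 (ext n y v) `&` X (n.+1 + m)%N @^-1` [set z]).
  rewrite setI_bigcupr; apply: eq_bigcupr => v _.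
  rewrite addSnnS; apply/seteqP; split=> w [] => [[_ ?]|/[dup] /cyl_ext [? _]] //.
rewrite measure_fin_bigcup//; first last.
- by move=> v _; apply: measurableI; [exact: mcyl|exact: (srw_measurable srw)].
- by move=> v1 v2 _ _ [w [[h1 _] [h2 _]]]; exact: cylU h1 h2.
rewrite (eq_fsbigr (fun v => (pr x n y * (step (y n) v * ptrans m v z))%:E)).
  by rewrite sum_nbrs /= mulr_sumr.
by move=> v _; apply: etrans (IH _ _) _; rewrite pr_ext mulrA /ext ltnn.
Qed.

Lemma prob_walk x k z : Px x (X k @^-1` [set z]) = (ptrans k x z)%:E.
Proof.
have P1 : Px x (cyl 0 (fun=> x)) = 1%E.
  by rewrite pcyl /pr eqxx big_ord0 mulr1.
have mk := srw_measurable srw k z.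
rewrite [LHS](measureDI _ mk (mcyl 0 (fun=> x))) [X in (X + _)%E](_ : _ = 0%E).
  rewrite add0e setIC; have := cyl_hit x 0 (fun=> x) k z; rewrite add0n => h.
  by apply: (etrans h); rewrite /pr eqxx big_ord0 !mul1r.
apply/eqP; rewrite eq_le measure_ge0 andbT.
have -> : 0%E = Px x (~` cyl 0 (fun=> x)).
  by rewrite probability_setC//; apply/esym; rewrite -[RHS](subee (x := 1%E))//; congr (_ - _)%E.
apply: le_measure; rewrite ?inE; last by move=> w [].
  by apply: measurableD => //; exact: mcyl.
by apply: measurableC; exact: mcyl.
Qed.

Lemma green_series x z :
  (green Px X x z = (deg z)%:R^-1%:E * \sum_(0 <= k <oo) (ptrans k x z)%:E)%E.
Proof.
rewrite /green; congr (_ * _)%E.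
have E k w : ((X k w == z)%:R)%:E = (\1_(X k @^-1` [set z]) w)%:E :> \bar R.
  rewrite indicE; congr ((nat_of_bool _)%:R)%:E.
  by apply/eqP/idP => [h|]; rewrite inE.
under eq_integral do under eq_eseriesr do rewrite E.
rewrite integral_nneseries//; first last.
  move=> k; apply/measurable_EFinP.
  by apply: measurable_indic; exact: (srw_measurable srw).
apply: eq_eseriesr => k _; rewrite integral_indic ?setIT//.
  by apply: etrans (prob_walk _ _ _) _.
exact (srw_measurable srw k z).
Qed.

Definition greenN N (x z : T) : R := \sum_(k < N) ptrans k x z.

Lemma greenN_rec N x z :
  greenN N.+1 x z = (x == z)%:R + \sum_(v <- nbrs x) step x v * greenN N v z.
Proof.
rewrite /greenN big_ord_recl /=; congr (_ + _); rewrite exchange_big /=.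
by apply: eq_bigr => v _; rewrite mulr_sumr.
Qed.

Lemma greenN_nondecreasing x z : nondecreasing_seq (fun N => greenN N x z).
Proof.
apply/nondecreasing_seqP => N.
by rewrite /greenN big_ord_recr /= lerDl ptrans_ge0.
Qed.

End WalkPaths.

Section GreenFunction.
Variables (R : realType) (T : rooted_tree).
Hypothesis deg_gt0 : forall x : T, (0 < deg x)%N.
Variable g : T -> T -> R.
Hypothesis greenN_cvg : forall x z : T,
  (fun N => greenN R N x z) @ \oo --> (deg z)%:R * g x z.

Local Notation step := (@step R T).
Local Notation greenN := (greenN R).
Let G (x z : T) : R := (deg z)%:R * g x z.

Let degR_gt0 (x : T) : 0 < (deg x)%:R :> R. Proof. by rewrite ltr0n. Qed.

Let greenN_le N x z : greenN N x z <= G x z.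
Proof.
rewrite /G -(cvg_lim _ (@greenN_cvg x z))//; apply: nondecreasing_cvgn_le.
  exact: greenN_nondecreasing.
by apply/cvg_ex; eexists; exact: greenN_cvg.
Qed.

Let G_le x z c : (forall N, greenN N x z <= c) -> G x z <= c.
Proof.
move=> h; rewrite /G -(cvg_lim _ (@greenN_cvg x z))//; apply: limr_le.
  by apply/cvg_ex; eexists; exact: greenN_cvg.
by near=> N; exact: h.
Unshelve. all: by end_near. Qed.

Let G_ge0 x z : 0 <= G x z.
Proof. by apply: le_trans (greenN_le 0 x z); rewrite /greenN big_ord0. Qed.

Lemma green_ge0 x z : 0 <= g x z.
Proof. by rewrite -(pmulr_rge0 _ (degR_gt0 z)); exact: G_ge0. Qed.

Let G_step x z : G x z = (x == z)%:R + \sum_(v <- nbrs x) step x v * G v z.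
Proof.
have h1 : (fun N => greenN N.+1 x z) @ \oo --> G x z.
  by rewrite (@cvg_shiftS _ (fun N => greenN N x z)); exact: greenN_cvg.
have h2 : (fun N => greenN N.+1 x z) @ \oo -->
    (x == z)%:R + \sum_(v <- nbrs x) step x v * G v z.
  rewrite (_ : (fun N => _) = fun N =>
    (x == z)%:R + \sum_(v <- nbrs x) step x v * greenN N v z); last first.
    by apply/funext => N; exact: greenN_rec.
  apply: cvgD; first exact: cvg_cst.
  apply: cvg_big => [|v _]; first exact: add_continuous.
  by apply: cvgMl_tmp; exact: greenN_cvg.
exact: (cvg_unique _ h1 h2).
Qed.

Definition separates (y x z : T) :=
  forall q, path (@adj T) x q -> last x q = z -> y \in x :: q.

Lemma separates_step y x z v : separates y x z -> x != y -> v \in nbrs x ->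
  separates y v z.
Proof.
move=> sep xy vx q pq lq; have := sep (v :: q).
by rewrite /= /adj vx pq inE eq_sym (negPf xy) => /(_ isT lq).
Qed.

Lemma separates_refl y x : separates y x x -> x = y.
Proof. by move/(_ [::] isT erefl); rewrite inE => /eqP. Qed.

Let G_separates y x z : separates y x z -> G x z * G y y = G x y * G y z.
Proof.
have ub N x' : separates y x' z -> greenN N x' z * G y y <= G x' y * G y z.
  elim: N x' => [|N IH] x' sep; first by rewrite /greenN big_ord0 mul0r mulr_ge0.
  have [xy|xy] := eqVneq x' y.
    by rewrite xy [leRHS]mulrC ler_wpM2r.
  have /negPf xz : x' != z.
    by apply: contraNneq xy => xz; apply/eqP/(@separates_refl y); rewrite {2}xz.
  rewrite greenN_rec (G_step x' y) xz (negPf xy) !add0r !mulr_suml !big_seq.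
  apply: ler_sum => v vx; rewrite -![step _ _ * _ * _]mulrA ler_wpM2l ?step_ge0// IH//.
  exact: separates_step vx.
have lb N x' : separates y x' z -> greenN N x' y * G y z <= G x' z * G y y.
  elim: N x' => [|N IH] x' sep; first by rewrite /greenN big_ord0 mul0r mulr_ge0.
  have [xy|xy] := eqVneq x' y.
    by rewrite xy [leRHS]mulrC ler_wpM2r.
  have /negPf xz : x' != z.
    by apply: contraNneq xy => xz; apply/eqP/(@separates_refl y); rewrite {2}xz.
  rewrite greenN_rec (G_step x' z) xz (negPf xy) !add0r !mulr_suml !big_seq.
  apply: ler_sum => v vx; rewrite -![step _ _ * _ * _]mulrA ler_wpM2l ?step_ge0// IH//.
  exact: separates_step vx.
have G_gt0 w : 0 < G w w.
  apply: lt_le_trans (greenN_le 1 w w).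
  by rewrite /greenN big_ord1 /= eqxx.
move=> sep; apply/eqP; rewrite eq_le; apply/andP; split.
  rewrite -ler_pdivlMr//; apply: G_le => N; rewrite ler_pdivlMr//; exact: ub.
have [->|Gyz] := eqVneq (G y z) 0; first by rewrite mulr0 mulr_ge0.
have {}Gyz : 0 < G y z by rewrite lt_neqAle eq_sym Gyz G_ge0.
by rewrite -ler_pdivlMr//; apply: G_le => N; rewrite ler_pdivlMr//; exact: lb.
Qed.

Lemma green_separates y x z : separates y x z -> g x z * g y y = g x y * g y z.
Proof.
move=> /G_separates; rewrite /G => h.
have dy := lt0r_neq0 (degR_gt0 y); have dz := lt0r_neq0 (degR_gt0 z).
apply: (mulfI dy); apply: (mulfI dz); transitivity (G x z * G y y).
  by rewrite /G; ring.
by rewrite /G h; ring.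
Qed.

Lemma green_gt0 x : 0 < g x x.
Proof.
rewrite -(pmulr_rgt0 _ (degR_gt0 x)); apply: lt_le_trans (greenN_le 1 x x).
by rewrite /greenN big_ord1 /= eqxx.
Qed.

Lemma green_le_diag x y : g x y <= g y y.
Proof.
rewrite -(ler_pM2l (degR_gt0 y)) -/(G x y) -/(G y y).
apply: G_le => N; elim: N x => [|N IH] x; first by rewrite /greenN big_ord0.
have [->|/negPf xy] := eqVneq x y; first exact: greenN_le.
rewrite greenN_rec xy add0r -[leRHS]mul1r -(sum_step R deg_gt0 x) mulr_suml.
by apply: ler_sum => v _; rewrite ler_wpM2l ?step_ge0.
Qed.

Lemma green_laplacian x z :
  (deg x)%:R * g x z = (x == z)%:R + \sum_(v <- nbrs x) g v z.
Proof.
have dz := lt0r_neq0 (degR_gt0 z); have dx := lt0r_neq0 (degR_gt0 x).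
apply: (mulfI dz); rewrite mulrCA -/(G x z) G_step !mulrDr; congr (_ + _).
  by have [->|] := eqVneq x z; rewrite ?mulr0.
rewrite !mulr_sumr big_seq [RHS]big_seq; apply: eq_bigr => v vx.
by rewrite step_nbr// mulVKf.
Qed.

(* Both sides come from the equation [(deg y) g y = delta_y + sum of g over the
   neighbours] evaluated at y and at p, since y separates p from its other
   neighbours. *)
Lemma green_edge y p : p \in nbrs y ->
    (forall v, v \in nbrs y -> v != p -> separates y v p) ->
  g p p * g y y = g y p * (1 + g p y).
Proof.
move=> py sep.
have e1 := green_laplacian y y; have e2 := green_laplacian y p.
have /negPf yp : y != p by apply: contraTneq py => ->; exact: tree_irrefl.
rewrite eqxx (big_fsetD1 p)//= in e1; rewrite yp add0r (big_fsetD1 p)//= in e2.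
have e3 : (\sum_(v <- (nbrs y `\ p)%fset) g v p) * g y y =
          (\sum_(v <- (nbrs y `\ p)%fset) g v y) * g y p.
  rewrite !mulr_suml big_seq [RHS]big_seq; apply: eq_bigr => v.
  by rewrite in_fsetD1 => /andP[vp vy]; exact: green_separates (sep _ vy vp).
set S1 := \sum_(_ <- _) _ in e1 e3; set S2 := \sum_(_ <- _) _ in e2 e3.
have -> : g p p = (deg y)%:R * g y p - S2 by rewrite e2; ring.
rewrite mulrBl e3 mulrAC e1; ring.
Qed.

End GreenFunction.

(** * Effective resistance and Green function *)

Section Distance.
Variable T : rooted_tree.
Implicit Types x y z : T.

Lemma dist_le x y p : path_between x y p -> (dist x y <= size p)%N.
Proof.
move=> xyp; rewrite /dist; case: ex_minnP => n _; apply.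
by apply/asboolP; exists p.
Qed.

Lemma geodesic_exists x y : exists p, geodesic x y p.
Proof.
rewrite /geodesic /dist; case: ex_minnP => n /asboolP[p xyp <-] _.
by exists p.
Qed.

Lemma distxx x : dist x x = 0%N.
Proof. by apply/eqP; rewrite -leqn0 (@dist_le _ _ [::]). Qed.

Lemma dist_adj x y z : z \in nbrs y -> (dist x z <= (dist x y).+1)%N.
Proof.
move=> yz; have [p [[pp lp] <-]] := geodesic_exists x y.
rewrite -(size_rcons p z); apply: dist_le.
by rewrite /path_between rcons_path last_rcons pp lp.
Qed.

End Distance.

Section Resistance.
Variables (R : realType) (T : rooted_tree).
Hypothesis deg_gt0 : forall x : T, (0 < deg x)%N.
Local Notation greenN := (greenN R).
Local Notation step := (@step R T).

Lemma energy_ge0 (S : set T) (f : T -> R) : (0 <= energy S f)%E.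
Proof.
by rewrite mule_ge0 ?lee_fin// esum_ge0// => e _; rewrite lee_fin sqr_ge0.
Qed.

Lemma Ceff_ge0 (S A B : set T) : (0 <= Ceff R S A B)%E.
Proof. by apply: le_ereal_inf_tmp => _ [f _ <-]; exact: energy_ge0. Qed.

(* Setting a test function to 0 beyond the sphere on which it vanishes does not
   increase its energy. *)
Lemma Reff_nondecreasing (S : set T) (x : T) :
  nondecreasing_seq (fun N : nat =>
    Reff R S [set x] [set y | S y /\ dist x y = N]).
Proof.
apply/nondecreasing_seqP => N; rewrite /Reff lee_pV2 ?inE ?Ceff_ge0//.
apply: le_ereal_inf_tmp => _ [f [f1 f0] <-].
pose f' y := if (dist x y <= N)%N then f y else 0.
apply: (@le_trans _ _ (energy S f')).
  apply: ereal_inf_lbound; exists f' => //; split=> [a ->|b [_ bN]].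
    by rewrite /f' distxx f1.
  by rewrite /f' bN ltnn.
rewrite lee_pmul2l ?lte_fin//; apply: le_esum => -[u v] [/= Su Sv uv].
rewrite lee_fin /f'; case: leqP => uN; case: leqP => vN //.
- have uE : dist x u = N.
    by apply/eqP; rewrite eqn_leq uN -ltnS (leq_trans vN (dist_adj _ uv)).
  by rewrite f0// subrr expr0n sqr_ge0.
- rewrite /adj tree_sym in uv; have vE : dist x v = N.
    by apply/eqP; rewrite eqn_leq vN -ltnS (leq_trans uN (dist_adj _ uv)).
  by rewrite [f v]f0// subrr expr0n sqr_ge0.
- by rewrite subrr expr0n sqr_ge0.
Qed.

Fixpoint walk_ends (k : nat) (x : T) : seq T :=
  if k is k'.+1 then flatten [seq enum_fset (nbrs v) | v <- walk_ends k' x]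
  else [:: x].

Lemma ptrans_support k x y : ptrans R k x y != 0 ->
  x \in walk_ends k y /\ (dist y x <= k)%N.
Proof.
elim: k x => [|k IH] x /=.
  by have [->|] := eqVneq x y; rewrite ?eqxx// inE distxx.
rewrite psumr_neq0 => [|v _]; last by rewrite mulr_ge0 ?step_ge0 ?ptrans_ge0.
move=> /hasP[v vx /=].
rewrite lt0r mulf_eq0 negb_or => /andP[/andP[_ /IH[vy dv]] _].
rewrite tree_sym in vx; split; last exact: leq_trans (dist_adj y vx) _.
by apply/flatten_mapP; exists v.
Qed.

Lemma greenN_support N x y : greenN N x y != 0 ->
  x \in flatten [seq walk_ends k y | k <- iota 0 N] /\ (dist y x < N)%N.
Proof.
rewrite psumr_neq0 => [|k _]; last exact: ptrans_ge0.
move=> /hasP[k _ /=].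
rewrite lt0r => /andP[/ptrans_support[xk yk] _].
split; last exact: leq_ltn_trans (ltn_ord k).
by apply/flatten_mapP; exists (k : nat); rewrite ?mem_iota ?add0n ?leq0n ?ltn_ord.
Qed.

Lemma ler_sum_subset (I : eqType) (F : I -> R) (s1 s2 : seq I) :
    (forall i, 0 <= F i) -> uniq s1 -> {subset s1 <= s2} ->
  \sum_(i <- s1) F i <= \sum_(i <- s2) F i.
Proof.
move=> F0; elim: s1 s2 => [|i s1 IH] s2 /= => [_ _|/andP[is1 us1] sub].
  by rewrite big_nil sumr_ge0.
rewrite (perm_big _ (perm_to_rem (sub i (mem_head _ _)))) !big_cons lerD2l.
apply: IH => // j js1; have := sub j; rewrite inE js1 orbT => /(_ isT).
rewrite (perm_mem (perm_to_rem (sub i (mem_head _ _)))) inE => /orP[/eqP ji|//].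
by rewrite -ji js1 in is1.
Qed.

(* Summation by parts on a finite set containing the support of f together with
   its neighbours. *)
Lemma energy_fin_support (S : set T) (f : T -> R) (D : seq T) (c : R) :
    (forall x, f x != 0 -> x \in D) ->
    \sum_(x <- undup D) f x * \sum_(v <- nbrs x) (f x - f v) <= c ->
  (energy S f <= c%:E)%E.
Proof.
move=> fD fc; rewrite /energy.
pose D1 := undup (D ++ flatten [seq enum_fset (nbrs v) | v <- D]).
have uD1 : uniq D1 by exact: undup_uniq.
have DD1 x : x \in D -> x \in D1 by rewrite mem_undup mem_cat => ->.
have nD1 x v : x \in D -> v \in nbrs x -> v \in D1.
  move=> xD vx; rewrite mem_undup mem_cat; apply/orP; right.
  by apply/flatten_mapP; exists x.
pose h (e : T * T) : R := (adj e.1 e.2)%:R * (f e.1 - f e.2) ^+ 2.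
have h0 e : 0 <= h e by rewrite mulr_ge0 ?sqr_ge0.
have hD1 e : h e != 0 -> e \in [seq (x, v) | x <- D1, v <- D1].
  case: e => x v; rewrite /h /= mulf_eq0 negb_or sqrf_eq0 pnatr_eq0 eqb0 negbK.
  move=> /andP[xv fxv]; apply/allpairsP; exists (x, v); rewrite /=.
  have [fx0|/fD xD] := eqVneq (f x) 0; last by split=> //; [exact: DD1|exact: nD1 xv].
  have [fv0|/fD vD] := eqVneq (f v) 0; first by rewrite fx0 fv0 subrr eqxx in fxv.
  rewrite /adj tree_sym in xv.
  by split=> //; [exact: nD1 xv|exact: DD1].
have sumD1 : \sum_(e <- [seq (x, v) | x <- D1, v <- D1]) h e <= 2 * c.
  rewrite big_allpairs /=.
  have hE x v : h (x, v) = (adj x v)%:R * (f x * (f x - f v)) +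
                           (adj v x)%:R * (f v * (f v - f x)).
    by rewrite /h /= /adj (tree_sym v x); ring.
  under eq_bigr do under eq_bigr do rewrite hE.
  under eq_bigr do rewrite big_split /=.
  rewrite big_split /= [X in _ + X]exchange_big /= -mulr2n -[leLHS]mulr_natl.
  rewrite ler_pM2l//; apply: le_trans fc; rewrite le_eqVlt; apply/orP; left.
  apply/eqP; transitivity (\sum_(x <- D1 | x \in D)
      f x * \sum_(v <- nbrs x) (f x - f v)).
    rewrite [RHS]big_mkcond; apply: eq_bigr => x _.
    case: ifPn => [xD|]; last first.
      move=> /(contraNN (@fD x)); rewrite negbK => /eqP ->.
      by rewrite big1// => v _; rewrite mul0r mulr0.
    rewrite mulr_sumr (eq_bigr (fun v => if adj x v then f x * (f x - f v) else 0)).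
      rewrite -big_mkcond -big_filter; apply: perm_big.
      apply: uniq_perm => [||v]; [exact: filter_uniq|exact: fset_uniq|].
      rewrite mem_filter /adj; apply: andb_idr; exact: nD1.
    by move=> v _; case: ifP => _; rewrite ?mul1r ?mul0r.
  rewrite -big_filter; apply: perm_big; apply: uniq_perm.
  - exact: filter_uniq.
  - exact: undup_uniq.
  - by move=> x; rewrite mem_filter !mem_undup; apply: andb_idr; rewrite mem_cat => ->.
have -> : c%:E = (2^-1%:E * (2 * c)%:E)%E by rewrite -EFinM mulKf.
rewrite lee_pmul2l ?lte_fin//; apply: ge_ereal_sup => _ [F [finF FS] <-].
rewrite fsbig_finite//= sumEFin lee_fin; apply: le_trans sumD1.
rewrite big_seq (eq_bigr h) => [|e]; last first.
  rewrite in_fset_set// inE => /FS [_ _ eadj].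
  by rewrite /h eadj mul1r.
rewrite -big_seq (bigID (fun e => h e == 0)) /= big1 ?add0r => [|e /eqP//].
rewrite -big_filter; apply: ler_sum_subset => //.
  by apply: filter_uniq; exact: fset_uniq.
by move=> e; rewrite mem_filter => /andP[/hD1].
Qed.

Lemma greenN_energy (S : set T) N y (a : R) :
  (energy S (fun x => a * greenN N x y)%R <=
   (a ^+ 2 * (deg y)%:R * greenN N y y)%:E)%E.
Proof.
pose D := y :: flatten [seq walk_ends k y | k <- iota 0 N].
apply: (@energy_fin_support S _ D) => [x|].
  by rewrite mulf_eq0 negb_or => /andP[_ /greenN_support[xD _]]; rewrite inE xD orbT.
have lap x : \sum_(v <- nbrs x) (greenN N x y - greenN N v y) <=
    (x == y)%:R * (deg y)%:R.
  rewrite big_split /= sumrN big_const_seq count_predT iter_addr_0.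
  rewrite -[size _]/(deg x) -[_ *+ deg x]mulr_natl.
  have -> : \sum_(v <- nbrs x) greenN N v y =
      (deg x)%:R * \sum_(v <- nbrs x) step x v * greenN N v y.
    rewrite mulr_sumr big_seq [RHS]big_seq; apply: eq_bigr => v vx.
    by rewrite step_nbr// mulVKf// pnatr_eq0 -lt0n.
  have := greenN_rec R N x y; have := greenN_nondecreasing R x y (leqnSn N).
  set G1 := greenN N.+1 x y; set s := \sum_(_ <- _) _.
  move=> G1G GE; rewrite -mulrBr.
  have -> : (x == y)%:R * (deg y)%:R = (deg x)%:R * (x == y)%:R :> R.
    by have [->|] := eqVneq x y; rewrite ?mulr0 ?mul0r ?mul1r ?mulr1.
  by rewrite ler_wpM2l// lerBlDr -GE.
apply: (@le_trans _ _ (\sum_(x <- undup D)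
    a ^+ 2 * (greenN N x y * ((x == y)%:R * (deg y)%:R)))).
  apply: ler_sum => x _ /=; under eq_bigr do rewrite -mulrBr.
  rewrite -mulr_sumr mulrACA -expr2 ler_wpM2l ?sqr_ge0// ler_wpM2l//.
  by apply: sumr_ge0 => k _; exact: ptrans_ge0.
have yD : y \in undup D by rewrite mem_undup mem_head.
rewrite (bigD1_seq y) ?undup_uniq//= eqxx mul1r [X in _ + X]big1 => [|x /negPf ->].
  by rewrite addr0 [greenN N y y * _]mulrC mulrA.
by rewrite mul0r !mulr0.
Qed.

Lemma greenN_le_Rinfty N (y : T) : ((greenN N y y / (deg y)%:R)%:E <= Rinfty R y)%E.
Proof.
rewrite /Rinfty; case: ifPn => _; first by rewrite leey.
have nd := @Reff_nondecreasing (subtree y) y.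
have d0 : 0 < (deg y)%:R :> R by rewrite ltr0n.
case: N => [|N].
  rewrite /greenN big_ord0 mul0r; apply: lime_ge.
    exact: ereal_nondecreasing_is_cvgn.
  by apply: nearW => n; rewrite inve_ge0 Ceff_ge0.
have G0 : 0 < greenN N.+1 y y.
  rewrite /greenN big_ord_recl /= eqxx ltr_pwDl// sumr_ge0// => k _.
  exact: (ptrans_ge0 R k.+1 y y).
have c0 : 0 < (deg y)%:R / greenN N.+1 y y by rewrite divr_gt0.
rewrite (cvg_lim _ (ereal_nondecreasing_cvgn nd))//.
apply: le_trans (ereal_sup_ubound (imageT _ N.+1)).
rewrite /Reff -[(_ / _)%:E]inveK lee_pV2 ?inE ?Ceff_ge0 ?inve_ge0//; last first.
  by rewrite lee_fin ltW// divr_gt0.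
rewrite inver gt_eqF ?divr_gt0// invf_div.
pose a := (greenN N.+1 y y)^-1.
apply: (@le_trans _ _ (energy (subtree y) (fun x => a * greenN N.+1 x y))).
  apply: ereal_inf_lbound; eexists; [|reflexivity].
  split=> [_ ->|b [_ bN]]; first by rewrite mulVf// gt_eqF.
  apply/eqP; rewrite mulf_eq0; apply/orP; right; apply: contraT.
  by move=> /greenN_support[_]; rewrite bN ltnn.
apply: le_trans (greenN_energy _ _ _ _) _.
by rewrite lee_fin /a expr2 -!mulrA [X in _ * X]mulrCA mulVf ?gt_eqF// mulr1 mulrC.
Qed.

End Resistance.

(** * Geodesics and separation *)

Section TreePaths.
Variable T : rooted_tree.
Implicit Types (x y z v w : T) (p q : seq T).

Lemma rev_adj_path x p : path (@adj T) x p ->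
  path (@adj T) (last x p) (rev (belast x p)) /\ last (last x p) (rev (belast x p)) = x.
Proof.
move=> xp; split; last by case: p xp => //= z p _; rewrite rev_cons last_rcons.
rewrite rev_path (eq_path (e' := @adj T))// => u v.
by rewrite /adj tree_sym.
Qed.

Lemma nbrs_separates y v w : v \in nbrs y -> w \in nbrs y -> v != w -> separates y v w.
Proof.
move=> vy wy vw q vq lq; apply: contraT => yq; rewrite -lq in wy vw.
case/shortenP: vq yq wy vw => q' vq' uq' sub yq wy vw.
have q'0 : q' != [::] by apply: contraNneq vw => ->.
have yq' : y \notin v :: q'.
  apply: contra yq; rewrite !inE => /orP[->//|/sub ->]; by rewrite orbT.
have /negP[] : ~~ cycle (fun u v => v \in nbrs u) (y :: v :: q').
  by apply: tree_acyclic => /=; [case: (q') q'0|rewrite yq'].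
rewrite /= vy rcons_path /=; apply/andP; split; first exact: vq'.
by rewrite tree_sym.
Qed.

Lemma uniq_path_separates x p y : path (@adj T) x p -> uniq (x :: p) ->
  y \in x :: p -> separates y x (last x p).
Proof.
move=> xp up; rewrite inE => /predU1P[-> q _ _|yp]; first exact: mem_head.
case/splitPr: yp xp up => p1 p2.
rewrite cat_path last_cat -cat_cons cat_uniq => xp /and3P[_ dis up].
case: p2 xp dis up => [|w p2] xp dis up; first by move=> q _ /= <-; exact: mem_last.
move: xp dis up; rewrite /= => /and4P[xp1 uy yw wp2] dis /andP[yp2 _] q xq lq.
have [yp1 wp1] : y \notin x :: p1 /\ w \notin x :: p1.
  by move: dis; rewrite !negb_or => /and3P[].
apply: contraT => yq.
have [r1 l1] := rev_adj_path xp1; have [r2 l2] := rev_adj_path wp2.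
have sub1 : y \notin rev (belast x p1).
  rewrite mem_rev; apply: contra yp1; exact: mem_belast.
have sub2 : y \notin rev (belast w p2).
  rewrite mem_rev; apply: contra yp2; exact: mem_belast.
have := @nbrs_separates y (last x p1) w _ yw _ (rev (belast x p1) ++ q ++ rev (belast w p2)).
rewrite !cat_path !last_cat l1 lq r1 xq r2 l2 => /(_ _ _ isT erefl).
rewrite -cat_cons !mem_cat (negPf sub2) orbF inE.
move: yq; rewrite inE negb_or => /andP[_ /negPf ->]; rewrite orbF (negPf sub1) orbF.
have ylast : y != last x p1 by apply: contraNneq yp1 => ->; exact: mem_last.
rewrite (negPf ylast) => h; apply: h; first by rewrite tree_sym.
by apply: contraNneq wp1 => <-; exact: mem_last.
Qed.

Lemma path_separates x p i j k : path (@adj T) x p -> uniq (x :: p) ->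
    (i <= j <= k)%N -> (k < size (x :: p))%N ->
  separates (nth x (x :: p) j) (nth x (x :: p) i) (nth x (x :: p) k).
Proof.
move=> xp up /andP[ij jk] ks.
pose s := drop i (take k.+1 (x :: p)).
have ss : size s = (k.+1 - i)%N by rewrite size_drop size_takel.
have nths m : (m <= k - i)%N -> nth x s m = nth x (x :: p) (i + m).
  by move=> mk; rewrite nth_drop nth_take// ltnS -leq_subRL ?(leq_trans ij).
have us : uniq s by rewrite drop_uniq// take_uniq.
have sors : sorted (@adj T) s by apply: drop_sorted; apply: take_sorted.
have := nths 0%N isT; have := nths (j - i)%N (leq_sub2r i jk).
have := nths (k - i)%N (leqnn _); rewrite addn0 !subnKC// ?(leq_trans ij)//.
have jms : (j - i < size s)%N by rewrite ss ltn_sub2r// ltnS (leq_trans ij).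
case: s ss us sors jms {nths} => [//|a s] ss us sors jms kE jE <-.
have -> : nth x (x :: p) k = last a s.
  have -> : last a s = nth x (a :: s) (size s) by rewrite (last_nth x).
  by rewrite -kE; congr nth; apply/eqP; rewrite -eqSS -subSn ?(leq_trans ij)// -ss.
rewrite -jE; apply: uniq_path_separates => //.
exact: mem_nth.
Qed.

Lemma geodesic_path x y p : geodesic x y p ->
  [/\ path (@adj T) x p, last x p = y & uniq (x :: p)].
Proof.
move=> [[xp lp] sp]; split=> //; case/shortenP: (xp) lp => p' xp' up' sub lp.
have h := dist_le (conj xp' lp); rewrite -sp in h.
apply: leq_size_uniq up' _ _ => // u; rewrite !inE => /orP[->//|/sub ->].
by rewrite orbT.
Qed.

Lemma cseg_geodesic x y p : geodesic x y p -> cseg x y = [set` x :: p].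
Proof.
move=> geo; have [xp lp up] := geodesic_path geo.
apply/seteqP; split=> z /=; last by move=> zp; exists p.
move=> [q geoq zq]; have [xq lq uq] := geodesic_path geoq.
apply: (uniq_path_separates xq uq zq) xp _; by rewrite lp lq.
Qed.

End TreePaths.

(** * Gaussian Markov chains with small correlations *)

Section Mean.
Variables (R : realType) (d : measure_display) (Omega : measurableType d).
Variable P : probability Omega R.
Implicit Types X Y : Omega -> R.

Definition has_mean X (m : R) : Prop :=
  P.-integrable setT (EFin \o X) /\ (\int[P]_w (X w)%:E = m%:E)%E.

Lemma has_meanD X Y m n : has_mean X m -> has_mean Y n ->
  has_mean (fun w => X w + Y w) (m + n).
Proof.
move=> [iX eX] [iY eY]; split; first exact: (integrableD _ iX iY).
by under eq_integral do rewrite EFinD; rewrite integralD// eX eY.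
Qed.

Lemma has_meanZ a X m : has_mean X m -> has_mean (fun w => a * X w) (a * m).
Proof.
move=> [iX eX]; split; first exact: (integrableZl _ a iX).
by under eq_integral do rewrite EFinM; rewrite integralZl// eX.
Qed.

Lemma has_mean_cst a : has_mean (fun=> a) a.
Proof.
split; first by apply: finite_measure_integrable_cst.
rewrite integral_cst// -[RHS]mule1; congr (_ * _)%E; exact: probability_setT.
Qed.

Lemma has_mean_sum (I : Type) (s : seq I) (X : I -> Omega -> R) (m : I -> R) :
  (forall i, has_mean (X i) (m i)) ->
  has_mean (fun w => \sum_(i <- s) X i w) (\sum_(i <- s) m i).
Proof.
move=> h; elim: s => [|i s IH].
  under [X in has_mean X _]funext do rewrite big_nil.
  by rewrite big_nil; exact: has_mean_cst.
under [X in has_mean X _]funext do rewrite big_cons.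
by rewrite big_cons; exact: has_meanD.
Qed.

Lemma has_mean_le X Y m n : has_mean X m -> has_mean Y n ->
  (forall w, X w <= Y w) -> m <= n.
Proof.
move=> [iX eX] [iY eY] XY; rewrite -lee_fin -eX -eY; apply: le_integral => //.
by move=> w _; rewrite lee_fin.
Qed.

Lemma has_mean_bounded X Y n : measurable_fun setT X -> has_mean Y n ->
  (forall w, `|X w| <= Y w) -> exists m, has_mean X m.
Proof.
move=> mX [iY eY] XY.
have iX : P.-integrable setT (EFin \o X).
  apply: (le_integrable _ _ _ iY) => //; first exact/measurable_EFinP.
  by move=> w _; rewrite lee_fin (le_trans (XY w)) ?ler_norm.
exists (fine (\int[P]_w (X w)%:E)%E); split=> //.
by rewrite fineK// integrable_fin_num.
Qed.

End Mean.

Section Recursion.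
Variable R : realType.
Implicit Types q h e : R.

(* [h] and [h_j] stand for E[W] and E[W e^{j r t Z}]; the three combinations are
   E[W f(Z')], E[W f(Z') e^{t Z'}] and E[W f(Z') e^{- t Z'}]. *)
Lemma weight_step q h e h0 h1 h2 h3 h4 :
    43 / 41 <= q <= 20 / 19 -> 0 <= e -> 20 * (20 * e) <= h ->
    h - e <= h0 <= h + e -> h - e <= h1 <= h + e -> h - e <= h2 <= h + e ->
    h - e <= h3 <= h + e -> h - e <= h4 <= h + e ->
  let N := (15 * (q * h1) - 7 * (q ^+ 4 * h2) + q ^+ 9 * h3) / 9 in
  [/\ 9 / 10 * h <= N, N <= 499 / 500 * h,
      (15 * (q ^+ 4 * h2) - 7 * (q ^+ 9 * h3) + q ^+ 16 * h4) / 9 <= 2 * N &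
      (15 * h0 - 7 * (q * h1) + q ^+ 4 * h2) / 9 <= 2 * N].
Proof.
move=> q1 e_ge0 eh h0b h1b h2b h3b h4b /=.
have prod (x xl xu y yl yu : R) : 0 <= xl -> 0 <= yl ->
    xl <= x <= xu -> yl <= y <= yu -> xl * yl <= x * y <= xu * yu.
  move=> xl0 yl0 /andP[? ?] /andP[? ?].
  by apply/andP; split; apply: ler_pM => //; [exact: le_trans xl0 _|exact: le_trans yl0 _].
have q2 : 43 / 41 * (43 / 41) <= q ^+ 2 <= 20 / 19 * (20 / 19).
  by rewrite expr2; apply: prod => //; rewrite divr_ge0.
have q4 : 52 / 43 <= q ^+ 4 <= 43 / 35.
  have /andP[l u] : 43 / 41 * (43 / 41) * (43 / 41 * (43 / 41)) <= q ^+ 4 <=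
                   20 / 19 * (20 / 19) * (20 / 19 * (20 / 19)).
    by rewrite (exprD q 2 2); apply: prod => //; rewrite !mulr_ge0.
  by apply/andP; split; [apply: le_trans l|apply: le_trans u _]; clear; lra.
have q8 : 16 / 11 <= q ^+ 8 <= 43 / 35 * (43 / 35).
  have /andP[l u] : 52 / 43 * (52 / 43) <= q ^+ 8 <= 43 / 35 * (43 / 35).
    by rewrite (exprD q 4 4); apply: prod => //; rewrite !mulr_ge0.
  by apply/andP; split; [apply: le_trans l|apply: le_trans u _]; clear; lra.
have q9 : 3 / 2 <= q ^+ 9 <= 35 / 22.
  have /andP[l u] : 16 / 11 * (43 / 41) <= q ^+ 9 <= 43 / 35 * (43 / 35) * (20 / 19).
    by rewrite exprSr; apply: prod => //; rewrite !mulr_ge0.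
  by apply/andP; split; [apply: le_trans l|apply: le_trans u _]; clear; lra.
have q16 : 1 <= q ^+ 16 <= 5 / 2.
  have /andP[l u] : 16 / 11 * (16 / 11) <= q ^+ 16 <= 43 / 35 * (43 / 35) * (43 / 35 * (43 / 35)).
    by rewrite (exprD q 8 8); apply: prod => //; rewrite !mulr_ge0.
  by apply/andP; split; [apply: le_trans l|apply: le_trans u _]; clear; lra.
have he : 0 <= h - e by clear -e_ge0 eh; lra.
have p1 : 0 <= 43 / 41 :> R by rewrite divr_ge0.
have p4 : 0 <= 52 / 43 :> R by rewrite divr_ge0.
have p9 : 0 <= 3 / 2 :> R by rewrite divr_ge0.
have /andP[] := prod _ _ _ _ _ _ p1 he q1 h1b.
have /andP[] := prod _ _ _ _ _ _ p4 he q4 h2b.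
have /andP[] := prod _ _ _ _ _ _ p9 he q9 h3b.
have /andP[] := prod _ _ _ _ _ _ ler01 he q16 h4b.
move: h0b => /andP[].
move: (q * h1) (q ^+ 4 * h2) (q ^+ 9 * h3) (q ^+ 16 * h4) => a b c d.
clear -e_ge0 eh => *.
by split; lra.
Qed.

End Recursion.

Section Chain.
Variables (R : realType) (d : measure_display) (Omega : measurableType d).
Variables (P : probability Omega R) (n : nat) (Z : nat -> Omega -> R).
Variables (C : nat -> nat -> R) (r : nat -> R).

Let lin (c : nat -> R) w : R := \sum_(k < n) c k * Z k w.
Let quad (c : nat -> R) : R := \sum_(k < n) \sum_(l < n) c k * c l * C k l.

Hypothesis mZ : forall k, (k < n)%N -> measurable_fun setT (Z k).
Hypothesis mgf : forall c,
  has_mean P (fun w => expR (lin c w)) (expR (quad c / 2)).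
Hypothesis C_sym : forall k l, (k < n)%N -> (l < n)%N -> C k l = C l k.
Hypothesis C_diag : forall k, (k < n)%N -> C k k = 1.
Hypothesis r_bound : forall i, (i.+1 < n)%N -> 0 <= r i <= (40 * 40)^-1.
Hypothesis C_markov : forall i j, (i.+1 < n)%N -> (j <= i)%N ->
  C j i.+1 = r i * C j i.

Let t : R := Num.sqrt (10^-1).

Let t_gt0 : 0 < t. Proof. by rewrite sqrtr_gt0 invr_gt0. Qed.

Let t2 : t ^+ 2 = 10^-1. Proof. by rewrite sqr_sqrtr// invr_ge0. Qed.

Let f (z : R) : R :=
  (15 * expR (t * z) - 7 * expR ((2 * t) * z) + expR ((3 * t) * z)) / 9.

Let fE z : f z = 1 + (expR (t * z) - 1) * (expR (t * z) - 3) ^+ 2 / 9.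
Proof.
rewrite /f (_ : 3 * t * z = t * z + t * z + t * z); last by ring.
rewrite (_ : 2 * t * z = t * z + t * z); last by ring.
by rewrite !expRD; field.
Qed.

Let f_ge0 z : 0 <= f z.
Proof.
rewrite fE; set u := expR _; have u0 : 0 < u by exact: expR_gt0.
have : 0 <= u * ((u - 7 / 2) ^+ 2 + 11 / 4).
  by apply: mulr_ge0; [exact: ltW|rewrite addr_ge0 ?sqr_ge0// divr_ge0].
rewrite (_ : u * _ = 9 * (1 + (u - 1) * (u - 3) ^+ 2 / 9)); last by field.
by rewrite pmulr_rge0.
Qed.

Let f_ge1 z : 0 <= z -> 1 <= f z.
Proof.
move=> z0; rewrite fE lerDl divr_ge0// mulr_ge0 ?sqr_ge0// subr_ge0.
by rewrite -expR0 ler_expR mulr_ge0// ltW.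
Qed.

Let add (c : nat -> R) i a (k : nat) : R := c k + a * (k == i)%:R.

Let addC c i a j b : add (add c i a) j b = add (add c j b) i a.
Proof. by apply/funext => k; rewrite /add addrAC. Qed.

Let add2 c i a b : add (add c i a) i b = add c i (a + b).
Proof. by apply/funext => k; rewrite /add mulrDl addrA. Qed.

Let sum_delta (i : nat) (F : nat -> R) : (i < n)%N ->
  \sum_(k < n) (k == i :> nat)%:R * F k = F i.
Proof.
move=> ni; rewrite (bigD1 (Ordinal ni))//= eqxx mul1r big1 ?addr0// => k ki.
rewrite (_ : (k == i :> nat) = false) ?mul0r//.
by apply/negbTE; apply: contraNneq ki => ki; apply/eqP/val_inj.
Qed.

Let lin_add c i a w : (i < n)%N -> lin (add c i a) w = lin c w + a * Z i w.
Proof.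
move=> ni; rewrite /lin /add; under eq_bigr do rewrite mulrDl -mulrA.
by rewrite big_split /= -mulr_sumr (sum_delta (fun k => Z k w) ni).
Qed.

Let quad_add c i a : (i < n)%N ->
  quad (add c i a) = quad c + 2 * a * (\sum_(k < n) c k * C k i) + a ^+ 2.
Proof.
move=> ni; rewrite /quad /add.
have E k : (k < n)%N ->
   \sum_(l < n) (c k + a * (k == i)%:R) * (c l + a * (l == i :> nat)%:R) * C k l =
   \sum_(l < n) c k * c l * C k l + a * (c k * C k i) +
   (k == i)%:R * (a * (\sum_(l < n) c l * C l k) + a ^+ 2 * C k i).
  move=> nk; rewrite -(sum_delta (fun l => C k l) ni) !mulr_sumr.
  rewrite -!big_split /= !mulr_sumr -big_split; apply: eq_bigr => l _ /=.
  rewrite (C_sym (ltn_ord l) nk); ring.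
rewrite (eq_bigr _ (fun (k : 'I_n) _ => E k (ltn_ord k))) !big_split /=.
rewrite -mulr_sumr (sum_delta (fun k => a * (\sum_(l < n) c l * C l k) + a ^+ 2 * C k i) ni).
by rewrite C_diag//; ring.
Qed.

Fixpoint tilted (i : nat) (c : nat -> R) : R :=
  if i is i'.+1 then (15 * tilted i' (add c i' t) - 7 * tilted i' (add c i' (2 * t))
                      + tilted i' (add c i' (3 * t))) / 9
  else expR (quad c / 2).

Let weight i w : R := \prod_(j < i) f (Z j w).

Let tilted_mean i c : (i <= n)%N ->
  has_mean P (fun w => weight i w * expR (lin c w)) (tilted i c).
Proof.
elim: i c => [|i IH] c ni /=.
  by under [X in has_mean _ X _]funext do rewrite /weight big_ord0 mul1r.
rewrite (_ : (fun w => _) = fun w =>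
    9^-1 * (15 * (weight i w * expR (lin (add c i t) w)) +
            ((-7) * (weight i w * expR (lin (add c i (2 * t)) w)) +
            weight i w * expR (lin (add c i (3 * t)) w)))); last first.
  apply/funext => w; rewrite /weight big_ord_recr /= /f !lin_add// !expRD.
  by field.
rewrite (_ : _ / 9 = 9^-1 * (15 * tilted i (add c i t) +
  ((-7) * tilted i (add c i (2 * t)) + tilted i (add c i (3 * t))))); last by field.
by apply: has_meanZ; apply: has_meanD; [|apply: has_meanD];
  try (apply: has_meanZ); apply: IH; exact: ltnW.
Qed.

Let tilted_markov i j c a : (i.+1 < n)%N -> (j <= i.+1)%N ->
    (forall k, (i < k)%N -> c k = 0) ->
  tilted j (add c i.+1 a) =
  expR (a ^+ 2 * (1 - r i ^+ 2) / 2) * tilted j (add c i (r i * a)).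
Proof.
move=> ni; elim: j c => [|j IH] c ji c0 /=.
  rewrite -expRD !quad_add//; last exact: ltnW.
  rewrite (_ : \sum_(k < n) c k * C k i.+1 = r i * \sum_(k < n) c k * C k i).
    by congr expR; ring.
  rewrite mulr_sumr; apply: eq_bigr => k _; case: (leqP k i) => ki.
    by rewrite C_markov//; ring.
  by rewrite c0// !mul0r mulr0.
have c0' b k : (i < k)%N -> add c j b k = 0.
  move=> ik; rewrite /add c0// (_ : (k == j) = false) ?mulr0 ?addr0//.
  by apply/negbTE; rewrite gtn_eqF// (leq_ltn_trans _ ik).
rewrite ![add (add c i.+1 a) j _]addC ![add (add c i (r i * a)) j _]addC.
rewrite !IH; try exact: ltnW; try exact: c0'.
ring.
Qed.

Let H i a := tilted i.+1 (add (fun=> 0) i a).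

Let H_mean i a : (i < n)%N ->
  has_mean P (fun w => weight i.+1 w * expR (a * Z i w)) (H i a).
Proof.
move=> ni; have := @tilted_mean i.+1 (add (fun=> 0) i a) ni.
congr has_mean; apply/funext => w; rewrite lin_add// /lin big1 ?add0r// => k _.
by rewrite mul0r.
Qed.

Let weight_ge0 i w : 0 <= weight i w.
Proof. exact: prodr_ge0. Qed.

Let H_ge0 i a : (i < n)%N -> 0 <= H i a.
Proof.
move=> ni; apply: has_mean_le (has_mean_cst P 0) (H_mean a ni) _ => w.
by rewrite mulr_ge0 ?expR_ge0.
Qed.

Let expR_convex (a x : R) : 0 <= a <= 1 -> expR (a * x) <= (1 - a) + a * expR x.
Proof.
move=> /andP[a0 a1]; set u := expR (a * x).
have u0 : 0 <= u by exact: expR_ge0.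
have h1 : u * (1 + (1 - a) * x) <= expR x.
  rewrite [leRHS](_ : _ = expR (a * x + (1 - a) * x)); last by congr expR; ring.
  by rewrite expRD ler_wpM2l// expR_ge1Dx.
have h2 : u * (1 - a * x) <= 1.
  by rewrite -[leRHS](expRxMexpNx_1 (a * x)) ler_wpM2l// expR_ge1Dx.
have := lerD (ler_wpM2l a0 h1) (ler_wpM2l (_ : 0 <= 1 - a) h2).
rewrite subr_ge0 mulr1 [a * expR x + _]addrC => /(_ a1) h; apply: le_trans h.
by rewrite le_eqVlt; apply/orP; left; apply/eqP; ring.
Qed.

Let H_convex i a s : (i < n)%N -> 0 <= a <= 1 ->
  H i (a * s) <= (1 - a) * H i 0 + a * H i s.
Proof.
move=> ni a01.
have := has_meanD (has_meanZ (1 - a) (H_mean 0 ni)) (has_meanZ a (H_mean s ni)).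
move=> hY; apply: has_mean_le (H_mean _ ni) hY _ => w /=.
rewrite mul0r expR0 mulr1 [(1 - a) * _]mulrC [a * (_ * _)]mulrCA -mulrDr.
by rewrite ler_wpM2l// -mulrA; exact: expR_convex.
Qed.

Let H_mid i a : (i < n)%N -> 2 * H i 0 <= H i a + H i (- a).
Proof.
move=> ni.
have := has_meanD (H_mean a ni) (H_mean (- a) ni).
move=> hY; apply: has_mean_le (has_meanZ 2 (H_mean 0 ni)) hY _ => w /=.
rewrite mul0r expR0 mulr1 -mulrDr mulrC ler_wpM2l// mulNr expRN.
have := expR_gt0 (a * Z i w); move: (expR _) => u u0.
rewrite -subr_ge0 (_ : _ - _ = (u - 1) ^+ 2 / u); last by field; rewrite gt_eqF.
by rewrite divr_ge0 ?sqr_ge0// ltW.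
Qed.

Let H_step i a : (i.+1 < n)%N ->
  H i.+1 a =
   (15 * (expR ((a + t) ^+ 2 * (1 - r i ^+ 2) / 2) * H i (r i * (a + t)))
   - 7 * (expR ((a + 2 * t) ^+ 2 * (1 - r i ^+ 2) / 2) * H i (r i * (a + 2 * t)))
   + expR ((a + 3 * t) ^+ 2 * (1 - r i ^+ 2) / 2) * H i (r i * (a + 3 * t))) / 9.
Proof.
move=> ni; transitivity ((15 * tilted i.+1 (add (add (fun=> 0) i.+1 a) i.+1 t) -
  7 * tilted i.+1 (add (add (fun=> 0) i.+1 a) i.+1 (2 * t)) +
  tilted i.+1 (add (add (fun=> 0) i.+1 a) i.+1 (3 * t))) / 9); first by [].
by rewrite !add2 !tilted_markov.
Qed.

Let gauss_factor (j : nat) (s : R) :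
  expR ((j%:R * t) ^+ 2 * s / 2) = expR (20^-1 * s) ^+ (j ^ 2).
Proof.
rewrite -expRM_natl exprMn t2; congr expR; rewrite natrX; by field.
Qed.

Let gauss_factor_bounds (s : R) : 40 / 41 <= s <= 1 ->
  43 / 41 <= expR (20^-1 * s) <= 20 / 19.
Proof.
move=> /andP[s0 s1]; apply/andP; split.
  by apply: le_trans (expR_ge1Dx _); lra.
apply: (@le_trans _ _ (expR 20^-1)); first by rewrite ler_expR; lra.
rewrite -[20^-1]opprK expRN -[leRHS]invrK lef_pV2 ?posrE ?expR_gt0//.
  by apply: le_trans (expR_ge1Dx _); rewrite invf_div; lra.
Qed.

Let H0E a (j1 j2 j3 : nat) : (0 < n)%N ->
    a + t = j1%:R * t -> a + 2 * t = j2%:R * t -> a + 3 * t = j3%:R * t ->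
  let q := expR 20^-1 in
  H 0 a = (15 * (q ^+ (j1 ^ 2) * 1) - 7 * (q ^+ (j2 ^ 2) * 1) + q ^+ (j3 ^ 2) * 1) / 9.
Proof.
move=> n0 e1 e2 e3 q.
have quad0 b : quad (add (fun=> 0) 0 b) = b ^+ 2.
  rewrite quad_add// [X in X + _ + _]big1 => [|k _].
    by rewrite big1 => [|k _]; rewrite ?mul0r// mulr0 !add0r.
  by rewrite big1// => l _; rewrite !mul0r.
rewrite /H /= !add2 !quad0 e1 e2 e3 /q -[20^-1]mulr1 -!gauss_factor.
by rewrite !mulr1.
Qed.

Let HSE i a (j1 j2 j3 : nat) : (i.+1 < n)%N ->
    a + t = j1%:R * t -> a + 2 * t = j2%:R * t -> a + 3 * t = j3%:R * t ->
  let q := expR (20^-1 * (1 - r i ^+ 2)) in let h j := H i (r i * j%:R * t) in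
  H i.+1 a =
    (15 * (q ^+ (j1 ^ 2) * h j1) - 7 * (q ^+ (j2 ^ 2) * h j2) + q ^+ (j3 ^ 2) * h j3) / 9.
Proof.
by move=> ni e1 e2 e3 q h; rewrite H_step// e1 e2 e3 !gauss_factor /h !mulrA.
Qed.

Let H_near i a : (i < n)%N -> H i t <= 2 * H i 0 -> H i (- t) <= 2 * H i 0 ->
    0 <= a <= 400^-1 ->
  H i 0 - H i 0 / 400 <= H i (a * t) <= H i 0 + H i 0 / 400.
Proof.
move=> ni up dn a01; have h0 := H_ge0 0 ni.
case/andP: a01 => a0 a1; have a01 : 0 <= a <= 1.
  by apply/andP; split=> //; apply: le_trans a1 _; lra.
have u1 := H_convex t ni a01; have u2 := H_convex (- t) ni a01.
have m := H_mid (a * t) ni; rewrite mulrN in u2.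
rewrite mulrBl mul1r in u1; rewrite mulrBl mul1r in u2.
have v1 := ler_wpM2l a0 up; have v2 := ler_wpM2l a0 dn; rewrite [a * (2 * _)]mulrCA in v1; rewrite [a * (2 * _)]mulrCA in v2.
have v3 := ler_wpM2r h0 a1; rewrite [400^-1 * _]mulrC in v3.
move: (H i 0 / 400) (a * H i t) (a * H i (- t)) (a * H i 0) (H i (a * t))
  (H i (- (a * t))) (H i 0) u1 u2 m v1 v2 v3.
move=> {a0 a1 a01 h0 up dn} e aht ahnt ah hat hnat h *; apply/andP; split; lra.
Qed.

Let H_invariant i : (i < n)%N ->
  [/\ 0 < H i 0, H i 0 <= (499 / 500) ^+ i.+1,
      H i t <= 2 * H i 0 & H i (- t) <= 2 * H i 0].
Proof.
have e0 (k : nat) : 0 + k%:R * t = k%:R * t by rewrite add0r.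
elim: i => [|i IH] ni.
  have qb : 43 / 41 <= expR (20^-1 : R) <= 20 / 19.
    by rewrite -[20^-1]mulr1; apply: gauss_factor_bounds; lra.
  have hb : 1 - 0 <= (1 : R) <= 1 + 0 by apply/andP; split; lra.
  have z0 : 0 <= (0 : R) by []; have z1 : 20 * (20 * 0) <= (1 : R) by rewrite !mulr0.
  have [lo hi up dn] := weight_step qb z0 z1 hb hb hb hb hb.
  set N := (_ / 9) in lo; rewrite -/N in hi up dn.
  have E0 : H 0 0 = N by rewrite (@H0E 0 1 2 3)//; ring.
  have Ep : H 0 t <= 2 * N by rewrite (@H0E t 2 3 4)//; ring.
  have Em : H 0 (- t) <= 2 * N.
    rewrite (@H0E (- t) 0 1 2)//; try ring.
    by rewrite (_ : _ ^+ (0 ^ 2) * 1 = 1); [exact: dn|rewrite mulr1].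
  by rewrite E0; split=> //; [apply: lt_le_trans lo; lra|rewrite expr1 -[leRHS]mulr1].
have [hpos hle hp hm] := IH (ltnW ni).
have /andP[r0 r1] := r_bound ni.
have qb : 43 / 41 <= expR (20^-1 * (1 - r i ^+ 2)) <= 20 / 19.
  apply: gauss_factor_bounds; apply/andP; split; last by rewrite gerBl sqr_ge0.
  nra.
have hb (j : nat) : (j <= 4)%N ->
    H i 0 - H i 0 / 400 <= H i (r i * j%:R * t) <= H i 0 + H i 0 / 400.
  move=> j4; apply: H_near => //; first exact: ltnW.
  rewrite mulr_ge0//=; apply: (@le_trans _ _ ((40 * 40)^-1 * 4)).
    by rewrite ler_pM// ler_nat.
  lra.
have z0 : 0 <= H i 0 / 400 by apply: divr_ge0; [exact: ltW|exact: ler0n].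
have z1 : 20 * (20 * (H i 0 / 400)) <= H i 0 by lra.
have [lo hi up dn] := weight_step qb z0 z1
  (hb 0%N isT) (hb 1%N isT) (hb 2%N isT) (hb 3%N isT) (hb 4%N isT).
set N := (_ / 9) in lo; rewrite -/N in hi up dn.
have E0 : H i.+1 0 = N by rewrite (@HSE i 0 1 2 3)//; ring.
have Ep : H i.+1 t <= 2 * N by rewrite (@HSE i t 2 3 4)//; ring.
have Em : H i.+1 (- t) <= 2 * N.
  rewrite (@HSE i (- t) 0 1 2)//; try ring.
  by rewrite (_ : _ ^+ (0 ^ 2) * H i (r i * 0%:R * t) = H i (r i * 0%:R * t));
    [exact: dn|rewrite mul1r].
rewrite E0; split=> //; first by apply: lt_le_trans lo; rewrite mulr_gt0.
apply: le_trans hi _; rewrite [leRHS]exprS.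
by apply: ler_wpM2l hle; apply: divr_ge0; exact: ler0n.
Qed.

Lemma prob_nonneg_chain : (0 < n)%N ->
  (P [set w | forall k, (k < n)%N -> (0 <= Z k w)%R] <= ((499 / 500) ^+ n)%:E)%E.
Proof.
move=> n0; set A := [set w | _].
have mA : measurable A.
  rewrite (_ : A = \bigcap_(k in `I_n) (Z k @^-1` `[0, +oo[)); last first.
    by apply/seteqP; split=> w /= h k kn; have := h k kn; rewrite /= in_itv /= andbT.
  apply: fin_bigcap_measurable => // k /= kn.
  by rewrite -[X in measurable X]setTI; apply: mZ.
have [_ Hn _ _] : [/\ 0 < H n.-1 0, H n.-1 0 <= (499 / 500) ^+ n.-1.+1,
      H n.-1 t <= 2 * H n.-1 0 & H n.-1 (- t) <= 2 * H n.-1 0].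
  by apply: H_invariant; rewrite prednK.
have nn : (n.-1 < n)%N by rewrite prednK.
rewrite prednK// in Hn; have [iH eH] := H_mean 0 nn.
rewrite -lee_fin -eH in Hn; apply: le_trans Hn.
rewrite -[A in leLHS]setIT -integral_indic//; apply: ge0_le_integral => //=.
- exact/measurable_EFinP/measurable_indic.
- exact: measurable_int iH.
move=> w _; rewrite lee_fin mul0r expR0 mulr1 indicE.
have [Aw|_] := boolP (w \in A); last exact: weight_ge0.
rewrite /weight prednK//; apply: (big_ind (fun x : R => 1 <= x)) => //.
  by move=> x y x1 y1; rewrite -[1]mulr1 ler_pM.
by move=> k _; apply: f_ge1; move: Aw; rewrite inE; apply.
Qed.

End Chain.

(** * Exponential moments of the free field *)

Section NormalDensity.
Variables (R : realType) (m s : R).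
Hypothesis s_gt0 : 0 < s.
Local Notation mu := (@lebesgue_measure R).
Local Open Scope ereal_scope.
Import HBNNSimple.

Let pdfM (f : measurableTypeR R -> R) : measurable_fun setT f ->
  measurable_fun [set: measurableTypeR R] (fun x => (f x * normal_pdf m s x)%:E).
Proof.
move=> mf; apply/measurable_EFinP; apply: measurable_funM => //.
exact: measurable_normal_pdf.
Qed.

Let integral_normal_nnsfun (f : {nnsfun (measurableTypeR R) >-> R}) :
  \int[normal_prob m s]_x (f x)%:E = \int[mu]_x (f x * normal_pdf m s x)%:E.
Proof.
rewrite integralT_nnsfun sintegralE.
have E x : (f x * normal_pdf m s x)%:E = \sum_(y \in range f)
    (y * (\1_(f @^-1` [set y]) x * normal_pdf m s x))%:E.
  rewrite fsumEFin//; congr _%:E; rewrite [in LHS]fimfunE !fsbig_finite//= mulr_suml.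
  by apply: eq_bigr => y _; rewrite mulrA.
under [RHS]eq_integral do rewrite E.
rewrite ge0_integral_fsum//; last 2 first.
- move=> y; under eq_fun do rewrite mulrA.
  by apply: pdfM; apply: measurable_funM => //; apply: measurable_indic; apply: measurable_funPTI => //; exact: measurable_set1.
- by move=> y x _; rewrite mulrA lee_fin mulr_ge0 ?normal_pdf_ge0//; rewrite -lee_fin EFinM nnfun_muleindic_ge0.
apply: eq_fsbigr => y; rewrite inE => -[x _ <-].
under [in RHS]eq_integral do rewrite EFinM.
rewrite ge0_integralZl//; first last.
- by rewrite lee_fin.
- by move=> z _; rewrite lee_fin mulr_ge0 ?normal_pdf_ge0.
- by apply: pdfM; apply: measurable_indic; apply: measurable_funPTI => //; exact: measurable_set1.
congr (_ * _).
transitivity (\int[mu]_(z in f @^-1` [set f x]) (normal_pdf m s z)%:E) => //.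
rewrite [LHS]integral_mkcond; apply: eq_integral => z _.
by rewrite patchE indicE; case: ifPn => _; rewrite ?mul1r ?mul0r.
Qed.

Lemma ge0_integral_normal_prob (f : measurableTypeR R -> R) :
    measurable_fun setT f -> (forall x, 0 <= f x)%R ->
  \int[normal_prob m s]_x (f x)%:E = \int[mu]_x (f x * normal_pdf m s x)%:E.
Proof.
move=> mf f0; have mf' : measurable_fun setT (EFin \o f) by exact/measurable_EFinP.
pose f_ := nnsfun_approx measurableT mf'.
have cvg_f x : (f_ n x)%:E @[n --> \oo] --> (f x)%:E.
  by apply: cvg_nnsfun_approx => // y _; rewrite lee_fin.
have nd_f x : {homo (fun n => (f_ n x)%R) : a b / (a <= b)%N >-> (a <= b)%R}.
  by move=> a b ab; exact/lefP/nd_nnsfun_approx.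
transitivity (limn (fun n => \int[normal_prob m s]_x (f_ n x)%:E)).
  rewrite -monotone_convergence//=.
  - by apply: eq_integral => x _; apply/esym/cvg_lim.
  - by move=> n; exact/measurable_EFinP.
  - by move=> n x _; rewrite lee_fin.
  - by move=> x _ a b ab; rewrite lee_fin nd_f.
under eq_fun do rewrite integral_normal_nnsfun.
rewrite -monotone_convergence//=.
- apply: eq_integral => x _; rewrite EFinM; apply/cvg_lim => //.
  under eq_fun do rewrite EFinM.
  by apply: cvgeZr => //; exact: cvg_f.
- by move=> n; exact: pdfM.
- by move=> n x _; rewrite lee_fin mulr_ge0 ?normal_pdf_ge0.
- by move=> x _ a b ab; rewrite lee_fin ler_wpM2r ?normal_pdf_ge0// nd_f.
Qed.

Lemma integral_normal_expR (a : R) : \int[normal_prob m s]_x (expR (a * x))%:E =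
  (expR (m * a + s ^+ 2 * a ^+ 2 / 2))%:E.
Proof.
rewrite ge0_integral_normal_prob; [|by apply: measurableT_comp => //; exact: mulrl_measurable|by move=> x; exact: expR_ge0].
have s0 : s != 0%R by rewrite gt_eqF.
have E x : (expR (a * x) * normal_pdf m s x =
    expR (m * a + s ^+ 2 * a ^+ 2 / 2) * normal_pdf (m + s ^+ 2 * a) s x)%R.
  rewrite /normal_pdf !(negPf s0) /normal_fun [LHS]mulrCA [RHS]mulrCA; congr (_ * _)%R.
  rewrite -!expRD; congr expR; rewrite -[(s ^+ 2 *+ 2)%R]mulr_natr; field.
  by rewrite s0.
under eq_integral do rewrite E EFinM.
rewrite integralZl//; last exact: integrable_normal_pdf.
by rewrite integral_normal_pdf mule1.
Qed.

End NormalDensity.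

Section GaussianMean.
Variables (R : realType) (d : measure_display) (Omega : measurableType d).
Variable P : probability Omega R.
Implicit Types X : Omega -> R.

Lemma gaussian_law_expR X : measurable_fun setT X ->
    gaussian_law (fun B => P (X @^-1` B)) ->
  exists m v, 0 <= v /\
    forall a, has_mean P (fun w => expR (a * X w)) (expR (m * a + v * a ^+ 2 / 2)).
Proof.
move=> mX law.
pose X' : Omega -> measurableTypeR R := X.
have mX' : measurable_fun setT X' by exact: mX.
have mexp a : measurable_fun [set: measurableTypeR R] (fun x => expR (a * x)).
  by apply: measurableT_comp => //; exact: mulrl_measurable.
have mean a e : (\int[pushforward P X']_x (expR (a * x))%:E = e%:E)%E ->
    has_mean P (fun w => expR (a * X w)) e.
  rewrite (ge0_integral_pushforward mX')//=; last exact/measurable_EFinP.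
  rewrite preimage_setT => he; split=> //; apply/integrableP; split.
    by apply/measurable_EFinP; exact: (measurableT_comp (mexp a) mX).
  under eq_integral do rewrite /= ger0_norm ?expR_ge0//.
  by rewrite he ltry.
case: law => [[m hm]|[m [s [s0 hs]]]].
  exists m, 0; split=> // a; apply: mean.
  rewrite (@eq_measure_integral _ _ _ _ (dirac (m : measurableTypeR R)))//.
    by rewrite integral_dirac ?diracT ?mul1e//= ?mul0r ?addr0 1?mulrC//; exact/measurable_EFinP.
  by move=> A mA _; exact: hm.
exists m, (s ^+ 2); split=> [|a]; first exact: sqr_ge0.
apply: mean; rewrite -integral_normal_expR//.
by apply: eq_measure_integral => A mA _; exact: hs.
Qed.

End GaussianMean.

Section ExponentialBounds.
Variable R : realType.
Implicit Types x y a : R.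

Lemma expR_norm_le x : expR `|x| <= expR x + expR (- x).
Proof.
by case: (ger0P x) => _; rewrite ?lerDl ?lerDr expR_ge0.
Qed.

Lemma norm_exprn_le k x : `|x| ^+ k <= expR (k%:R * `|x|).
Proof.
rewrite expRM_natl lerXn2r ?nnegrE ?expR_ge0//.
by rewrite (le_trans _ (expR_ge1Dx _))// lerDr.
Qed.

(* Both bounds follow from e^y + e^{-y} - 2 = (2 sinh (y/2))^2 and
   h (2 - h) <= 2 sinh h <= 2 h e^h for h >= 0. *)
Lemma cosh_bounds y : 0 <= y ->
  y ^+ 2 - y ^+ 3 * expR y <= expR y + expR (- y) - 2 <= y ^+ 2 + y ^+ 3 * expR y.
Proof.
move=> y0; have [h [h0 yE]] : exists h, 0 <= h /\ y = h + h.
  by exists (y / 2); rewrite divr_ge0//; split=> //; field.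
have u1 := expR_ge1Dx h; have v1 := expR_ge1Dx (- h).
have w1 := expR_ge1Dx (- y); have y1 := expR_ge1Dx y.
have eu : expR y = expR h ^+ 2 by rewrite yE expRD.
have ev : expR (- y) = expR (- h) ^+ 2 by rewrite yE opprD expRD.
have uv := expRxMexpNx_1 h; have uv2 := expRxMexpNx_1 y.
have u0 := expR_gt0 h; have v0 := expR_gt0 (- h).
pose S := expR h - expR (- h).
have SE : expR y + expR (- y) - 2 = S ^+ 2.
  by rewrite eu ev /S sqrrB uv; ring.
have S_le : S <= y * expR h.
  have : (1 - y) * expR h <= expR (- h).
    rewrite (_ : - h = - y + h); last by rewrite yE; ring.
    by rewrite expRD ler_pM2r.
  by rewrite /S; lra.
have v_le1 : expR (- h) <= 1 by rewrite -expR0 ler_expR oppr_le0.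
have S_ge0 : 0 <= S by rewrite /S; lra.
have S_ge : h * (2 - h) <= S.
  have : h * expR (- h) <= 1 - expR (- h).
    have : (1 + h) * expR (- h) <= 1 by rewrite -[leRHS]uv ler_pM2r.
    by lra.
  have : h * (1 - h) <= h * expR (- h) by rewrite ler_wpM2l.
  by rewrite /S; lra.
have ey : expR y <= 1 + y * expR y.
  have : (1 - y) * expR y <= 1 by rewrite -[leRHS]uv2 mulrC ler_pM2l ?expR_gt0.
  by lra.
have e1 : 1 <= expR y by apply: le_trans y1; rewrite lerDl.
have y3 : 0 <= y ^+ 3 by rewrite exprn_ge0.
have y3e : y ^+ 3 <= y ^+ 3 * expR y by rewrite ler_peMr.
rewrite SE; apply/andP; split; last first.
  apply: (@le_trans _ _ ((y * expR h) ^+ 2)).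
    by rewrite lerXn2r ?nnegrE ?mulr_ge0// ltW.
  rewrite exprMn -eu [y ^+ 3]exprSr -mulrA -[X in _ <= X + _]mulr1 -mulrDr.
  by rewrite ler_wpM2l ?sqr_ge0.
have [y4|y4] := leP y 4; last first.
  apply: le_trans (sqr_ge0 _); rewrite subr_le0; apply: le_trans y3e.
  by rewrite exprS -[leLHS]mul1r ler_wpM2r ?sqr_ge0//; lra.
apply: (@le_trans _ _ ((h * (2 - h)) ^+ 2)); last first.
  by rewrite lerXn2r ?nnegrE// mulr_ge0//; lra.
apply: (@le_trans _ _ (y ^+ 2 - y ^+ 3)); first by rewrite lerD2l lerN2.
rewrite yE -subr_ge0.
have -> : (h * (2 - h)) ^+ 2 - ((h + h) ^+ 2 - (h + h) ^+ 3) =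
  h ^+ 3 * 4 + h ^+ 4 by ring.
by rewrite addr_ge0 ?mulr_ge0 ?exprn_ge0.
Qed.

Lemma cosh_scale_bounds a x : 0 < a <= 1 ->
  a ^+ 2 * x ^+ 2 - a ^+ 3 * (expR (4 * x) + expR (- 4 * x)) <=
    expR (a * x) + expR (- a * x) - 2 <=
  a ^+ 2 * x ^+ 2 + a ^+ 3 * (expR (4 * x) + expR (- 4 * x)).
Proof.
move=> /andP[a0 a1].
have := @cosh_bounds `|a * x| (normr_ge0 _).
have -> : expR `|a * x| + expR (- `|a * x|) = expR (a * x) + expR (- a * x).
  by rewrite mulNr; case: (ger0P (a * x)) => _; rewrite ?opprK 1?addrC.
rewrite real_normK ?num_real// exprMn.
suff : `|a * x| ^+ 3 * expR `|a * x| <= a ^+ 3 * (expR (4 * x) + expR (- 4 * x)).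
  by move=> h /andP[l u]; apply/andP; split; lra.
rewrite normrM (ger0_norm (ltW a0)) exprMn -mulrA ler_pM2l ?exprn_gt0//.
apply: (@le_trans _ _ (expR `|4 * x|)); last first.
  by rewrite mulNr; exact: expR_norm_le.
rewrite (_ : `|4 * x| = 3 * `|x| + `|x|); last by rewrite normrM ger0_norm//; ring.
rewrite expRD ler_pM ?exprn_ge0 ?expR_ge0//; first exact: norm_exprn_le.
by rewrite ler_expR ler_piMl.
Qed.

End ExponentialBounds.

Section GaussianMoments.
Variables (R : realType) (d : measure_display) (Omega : measurableType d).
Variable P : probability Omega R.
Variables (X : Omega -> R) (m v : R).
Hypothesis v_ge0 : 0 <= v.
Hypothesis X_expR : forall a,
  has_mean P (fun w => expR (a * X w)) (expR (m * a + v * a ^+ 2 / 2)).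
Hypothesis X_mean : has_mean P X 0.

Lemma gaussian_mean_eq0 : m = 0.
Proof.
have key a : 0 <= m * a + v * a ^+ 2 / 2.
  have := has_mean_le (has_meanD (has_mean_cst P 1) (has_meanZ a X_mean)) (X_expR a)
    (fun w => expR_ge1Dx _).
  by rewrite mulr0 addr0 -[leLHS]expR0 ler_expR.
have v1 : 0 < v + 1 by rewrite ltr_wpDl.
have := key (- m / (v + 1)).
have -> : m * (- m / (v + 1)) + v * (- m / (v + 1)) ^+ 2 / 2 =
  - (m ^+ 2 * ((v + 2) / (2 * (v + 1) ^+ 2))) by field; rewrite gt_eqF.
rewrite oppr_ge0 pmulr_lle0 => [|]; last first.
  by rewrite divr_gt0 ?mulr_gt0 ?exprn_gt0// ltr_wpDl.
by move=> m2; apply/eqP; rewrite -sqrf_eq0 eq_le m2 sqr_ge0.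
Qed.

Lemma gaussian_variance s : has_mean P (fun w => X w ^+ 2) s -> s = v.
Proof.
move=> hs; pose K := 2 * expR (v * 8).
have m0 := gaussian_mean_eq0.
have e4 : has_mean P (fun w => expR (4 * X w) + expR (- 4 * X w)) K.
  have := has_meanD (X_expR 4) (X_expR (- 4)).
  rewrite m0 !mul0r !add0r sqrrN /K (_ : v * 4 ^+ 2 / 2 = v * 8); last by field.
  by rewrite [2 * _]mulr_natl mulr2n.
have K0 : 0 <= K by rewrite mulr_ge0 ?expR_ge0.
have bounds a : 0 < a <= 1 ->
    a ^+ 2 * s - a ^+ 3 * K <= 2 * expR (v * a ^+ 2 / 2) - 2 <= a ^+ 2 * s + a ^+ 3 * K.
  move=> a01.
  have ea := has_meanD (has_meanD (X_expR a) (X_expR (- a))) (has_mean_cst P (- 2)).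
  rewrite m0 !mul0r !add0r sqrrN -[expR _ + expR _]mulr2n -[expR _ *+ 2]mulr_natl in ea.
  have l := has_meanD (has_meanZ (a ^+ 2) hs) (has_meanZ (- a ^+ 3) e4).
  have u := has_meanD (has_meanZ (a ^+ 2) hs) (has_meanZ (a ^+ 3) e4).
  rewrite -mulNr; apply/andP; split.
    apply: has_mean_le l ea _ => w; rewrite [- a ^+ 3 * _]mulNr.
    by have /andP[] := cosh_scale_bounds (X w) a01.
  apply: has_mean_le ea u _ => w.
  by have /andP[] := cosh_scale_bounds (X w) a01.
have D_ge0 : 0 <= K + v ^+ 2 by rewrite addr_ge0// sqr_ge0.
have small e : 0 < e -> exists a, [/\ 0 < a <= 1, a * (K + v ^+ 2) <= e & a * v <= 1].
  move=> e0; have q_ge0 : 0 <= (K + v ^+ 2) / e by apply: divr_ge0 => //; exact: ltW.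
  have D0 : 0 < (K + v ^+ 2) / e + v + 1 by apply: ltr_wpDl => //; exact: addr_ge0.
  exists ((K + v ^+ 2) / e + v + 1)^-1; split.
  - by rewrite invr_gt0 D0/= invf_le1// lerDr addr_ge0.
  - rewrite mulrC ler_pdivrMr// -ler_pdivrMl// mulrC -addrA lerDl addr_ge0//.
  - by rewrite mulrC ler_pdivrMr// mul1r addrAC lerDr addr_ge0.
apply/eqP; rewrite eq_le; apply/andP; split; apply/ler_addgt0Pr => e e0.
  have [a [a01 aK av]] := small e e0; have /andP[a0 a1] := a01.
  have /andP[h _] := bounds a a01.
  pose y := v * a ^+ 2 / 2.
  have y0 : 0 <= y by apply: divr_ge0 => //; apply: mulr_ge0 => //; exact: sqr_ge0.
  have y1 : y <= 2^-1.
    rewrite /y ler_piMl ?invr_ge0// expr2 mulrA [v * a]mulrC.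
    by apply: mulr_ile1 => //; [apply: mulr_ge0 => //|]; exact: ltW.
  have ey : expR y <= 1 + y + 2 * y ^+ 2.
    have i0 : 0 < 1 - y by lra.
    have : (1 - y) * expR y <= 1.
      by rewrite -[leRHS](expRxMexpNx_1 y) mulrC ler_pM2l ?expR_gt0// expR_ge1Dx.
    rewrite mulrC -ler_pdivlMr// => /le_trans; apply.
    rewrite ler_pdivrMr// -subr_ge0.
    have -> : (1 + y + 2 * y ^+ 2) * (1 - y) - 1 = y ^+ 2 * (1 - 2 * y) by ring.
    by rewrite mulr_ge0 ?sqr_ge0//; lra.
  have a2 : 0 < a ^+ 2 by rewrite exprn_gt0.
  rewrite -(ler_pM2l a2).
  have : 2 * y + 4 * y ^+ 2 = a ^+ 2 * v + a ^+ 2 * (a * (a * v ^+ 2)) by rewrite /y; field.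
  have : a ^+ 2 * (a * (a * v ^+ 2)) <= a ^+ 2 * (a * v ^+ 2).
    by rewrite ler_pM2l// ler_pM2l// ler_piMl ?sqr_ge0.
  have : a ^+ 2 * (a * (K + v ^+ 2)) <= a ^+ 2 * e by rewrite ler_pM2l.
  move: h ey; rewrite -/y exprS.
  by move: (expR y) (y ^+ 2) => E y2 *; lra.
have [a [a01 aK av]] := small e e0; have /andP[a0 a1] := a01.
have /andP[_ h] := bounds a a01.
have a2 : 0 < a ^+ 2 by rewrite exprn_gt0.
rewrite -(ler_pM2l a2).
have := expR_ge1Dx (v * a ^+ 2 / 2).
have : a ^+ 2 * (a * (K + v ^+ 2)) <= a ^+ 2 * e by rewrite ler_pM2l.
have : 0 <= a ^+ 2 * (a * v ^+ 2).
  by apply: mulr_ge0; [exact: ltW|apply: mulr_ge0; [exact: ltW|exact: sqr_ge0]].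
by move: h; rewrite exprS; move: (expR _) => E *; lra.
Qed.

End GaussianMoments.

Section FreeField.
Variables (R : realType) (T : rooted_tree).
Variables (d : measure_display) (Omega : measurableType d).
Variables (P : probability Omega R) (phi : T -> {RV P >-> R}).
Variable g : T -> T -> \bar R.
Hypothesis gff : gaussian_free_field phi g.

Let phi_expR x : exists m v, 0 <= v /\
  forall a, has_mean P (fun w => expR (a * phi x w)) (expR (m * a + v * a ^+ 2 / 2)).
Proof.
apply: gaussian_law_expR; first exact: measurable_funP.
have := gff_gaussian gff [:: x] (fun=> 1).
by congr gaussian_law; apply/funext => B; congr (P (_ @^-1` B));
  apply/funext => w; rewrite big_seq1 mul1r.
Qed.

Let phi_moment x k : exists c, has_mean P (fun w => `|phi x w| ^+ k) c.
Proof.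
have [m [v [_ h]]] := phi_expR x.
apply: has_mean_bounded (has_meanD (h k%:R) (h (- k%:R))) _.
  by apply: measurable_funX; apply: measurableT_comp => //; exact: measurable_funP.
move=> w; rewrite normrX normr_id; apply: le_trans (norm_exprn_le _ _) _.
apply: le_trans (_ : expR `|k%:R * phi x w| <= _).
  by rewrite normrM ger0_norm.
by rewrite mulNr; exact: expR_norm_le.
Qed.

Lemma gff_mean x : has_mean P (phi x) 0.
Proof.
have [c /has_mean_bounded h] := phi_moment x 1.
have [] := h (phi x) (measurable_funP _); first by move=> w; rewrite expr1.
move=> e [ie he]; have := gff_centered gff x; rewrite unlock he => -[e0].
by split=> //; rewrite he e0.
Qed.

Lemma gff_cov x y :
  g x y = (fine (g x y))%:E /\ has_mean P (fun w => phi x w * phi y w) (fine (g x y)).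
Proof.
have [cx hx] := phi_moment x 2; have [cy hy] := phi_moment y 2.
have [c hc] : exists c, has_mean P (fun w => phi x w * phi y w) c.
  apply: has_mean_bounded (has_meanD hx hy) _.
    by apply: measurable_funM; exact: measurable_funP.
  move=> w; rewrite normrM; have := sqr_ge0 (`|phi x w| - `|phi y w|).
  rewrite sqrrB -mulr_natr; have : 0 <= `|phi x w| * `|phi y w| by rewrite mulr_ge0.
  by lra.
have -> : g x y = c%:E; last by [].
rewrite -(gff_covariance gff) unlock !(gff_centered gff) unlock -hc.2 /=.
by apply: eq_integral => w _; rewrite !fctE /= !subr0.
Qed.

Lemma gff_expR n (z : nat -> T) (a : nat -> R) : uniq (mkseq z n) ->
  has_mean P (fun w => expR (\sum_(k < n) a k * phi (z k) w))
    (expR ((\sum_(k < n) \sum_(l < n) a k * a l * fine (g (z k) (z l))) / 2)).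
Proof.
move=> uz; pose L w := \sum_(k < n) a k * phi (z k) w.
have mL : measurable_fun setT L.
  by apply: measurable_sum => k; apply: measurable_funM => //; exact: measurable_funP.
have L0 : has_mean P L 0.
  have -> : 0 = \sum_(k < n) a k * 0 by rewrite big1// => k _; rewrite mulr0.
  by apply: has_mean_sum => k; apply: has_meanZ; exact: gff_mean.
have L2 : has_mean P (fun w => L w ^+ 2)
    (\sum_(k < n) \sum_(l < n) a k * a l * fine (g (z k) (z l))).
  rewrite (_ : (fun w => _) = fun w => \sum_(k < n) \sum_(l < n)
      a k * a l * (phi (z k) w * phi (z l) w)); last first.
    apply/funext => w; rewrite /L expr2 big_distrlr; apply: eq_bigr => k _.
    by apply: eq_bigr => l _; rewrite mulrACA.
  apply: has_mean_sum => k; apply: has_mean_sum => l; apply: has_meanZ.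
  exact: (gff_cov _ _).2.
have law : gaussian_law (fun B => P (L @^-1` B)).
  have := gff_gaussian gff (mkseq z n) (fun x => a (index x (mkseq z n))).
  congr gaussian_law; apply/funext => B; congr (P (_ @^-1` B)); apply/funext => w.
  rewrite /L big_map -{1}[n]subn0 big_mkord; apply: eq_bigr => k _.
  by rewrite -{1}(nth_mkseq (z 0%N) z (ltn_ord k)) index_uniq ?size_mkseq.
have [m [v [v0 h]]] := gaussian_law_expR mL law.
have := h 1; rewrite (gaussian_mean_eq0 v0 h L0) (gaussian_variance v0 h L0 L2).
by rewrite mul0r add0r expr1n mulr1; under eq_fun do rewrite mul1r.
Qed.

End FreeField.

(** * Good sites along a geodesic *)

Section Correlation.
Variables (R : realType) (T : rooted_tree).
Hypothesis deg_gt0 : forall x : T, (0 < deg x)%N.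
Variable g : T -> T -> R.
Hypothesis greenN_cvg : forall x z : T,
  (fun N => greenN R N x z) @ \oo --> (deg z)%:R * g x z.
Hypothesis g_sym : forall x y, g x y = g y x.

Definition corr (x y : T) : R := g x y / (Num.sqrt (g x x) * Num.sqrt (g y y)).

Let g_gt0 x : 0 < g x x. Proof. exact: green_gt0. Qed.

Let sqrt_neq0 x : Num.sqrt (g x x) != 0.
Proof. by rewrite gt_eqF// sqrtr_gt0. Qed.

Lemma corr_sym x y : corr x y = corr y x.
Proof. by rewrite /corr g_sym [X in _ / X]mulrC. Qed.

Lemma corr_refl x : corr x x = 1.
Proof. by rewrite /corr -expr2 sqr_sqrtr ?ltW// divff// gt_eqF. Qed.

Lemma corr_ge0 x y : 0 <= corr x y.
Proof. by rewrite divr_ge0 ?mulr_ge0 ?sqrtr_ge0//; exact: green_ge0. Qed.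

Lemma sqr_corr x y : corr x y ^+ 2 = g x y ^+ 2 / (g x x * g y y).
Proof. by rewrite /corr expr_div_n exprMn !sqr_sqrtr ?ltW. Qed.

Lemma sqr_corr_le1 x y : corr x y ^+ 2 <= 1.
Proof.
rewrite sqr_corr ler_pdivrMr ?mulr_gt0// mul1r expr2 ler_pM//; try exact: green_ge0.
  by rewrite g_sym; exact: green_le_diag.
exact: green_le_diag.
Qed.

Lemma corr_separates x y z : separates y x z -> corr x z = corr x y * corr y z.
Proof.
move=> /(green_separates deg_gt0 greenN_cvg) h; rewrite /corr.
have -> : g x z = g x y * g y z / Num.sqrt (g y y) ^+ 2.
  by rewrite sqr_sqrtr ?ltW// -h mulfK// gt_eqF.
by field; rewrite !sqrt_neq0.
Qed.

Lemma sqr_corr_edge x y (A : R) : x \in nbrs y -> 0 < A -> g y y <= A ->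
  corr x y ^+ 2 <= A / (1 + A).
Proof.
move=> xy A0 gA.
have e : g x x * g y y = g y x * (1 + g x y).
  by apply: (green_edge deg_gt0 greenN_cvg) => // v vy vx; exact: nbrs_separates.
have gxy_ge0 : 0 <= g x y by exact: green_ge0.
have gxyA : g x y <= A by apply: le_trans gA; exact: green_le_diag.
have gxy_neq0 : g x y != 0.
  apply/eqP => g0; have := mulr_gt0 (g_gt0 x) (g_gt0 y).
  by rewrite e -[g y x]g_sym g0 mul0r ltxx.
have g1 : 0 < 1 + g x y by rewrite ltr_pwDl.
have A1 : 0 < 1 + A by rewrite ltr_pwDl// ltW.
rewrite sqr_corr e -[g y x]g_sym expr2 -mulf_div divff// mul1r.
by rewrite ler_pdivrMr// mulrAC ler_pdivlMr// !mulrDr !mulr1 [A * _]mulrC lerD2r.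
Qed.

Lemma green_diag_le (A : R) y : (Rinfty R y <= A%:E)%E -> g y y <= A.
Proof.
move=> yA; have dy : 0 < (deg y)%:R :> R by rewrite ltr0n.
rewrite -(ler_pM2l dy) -(cvg_lim _ (@greenN_cvg y y))//; apply: limr_le.
  by apply/cvg_ex; eexists; exact: greenN_cvg.
apply: nearW => N; rewrite -ler_pdivrMl// mulrC -lee_fin.
exact: le_trans (greenN_le_Rinfty R deg_gt0 N y) yA.
Qed.

End Correlation.

Section Sampling.
Variables (R : realType) (T : rooted_tree).
Hypothesis deg_gt0 : forall x : T, (0 < deg x)%N.
Variables (d : measure_display) (Omega : measurableType d).
Variables (P : probability Omega R) (phi : T -> {RV P >-> R}).
Variable green : T -> T -> \bar R.
Hypothesis gff : gaussian_free_field phi green.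
Let g x y := fine (green x y).
Hypothesis greenN_cvg : forall x z : T,
  (fun N => greenN R N x z) @ \oo --> (deg z)%:R * g x z.
Variables (N : nat) (y : nat -> T) (theta : R) (L : nat).
Hypothesis y_uniq : uniq (mkseq y N).
Hypothesis y_separates : forall i j k, (i <= j <= k)%N -> (k < N)%N ->
  separates (y j) (y i) (y k).
Hypothesis y_corr : forall i, (i.+1 < N)%N -> corr g (y i) (y i.+1) ^+ 2 <= theta.
Hypothesis L_gt0 : (0 < L)%N.
Hypothesis theta_L : theta ^+ L <= (40 * 40)^-1 ^+ 2.

Let g_sym x z : g x z = g z x.
Proof. by rewrite /g -!(gff_covariance gff) covarianceC. Qed.

Let corr_iter i l : (i + l < N)%N -> corr g (y i) (y (i + l)) ^+ 2 <= theta ^+ l.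
Proof.
elim: l => [|l IH] il; first by rewrite addn0 corr_refl// !expr1n.
rewrite (corr_separates deg_gt0 greenN_cvg (y := y (i + l))); last first.
  by apply: y_separates => //; rewrite leq_addr addnS leqnSn.
rewrite exprMn [theta ^+ _]exprSr ler_pM ?sqr_ge0//; last first.
  by rewrite addnS; apply: y_corr; rewrite -addnS.
by apply: IH; rewrite (ltn_trans _ il)// addnS.
Qed.

Let z k := y (k * L).

Let zE k : (k < N %/ L)%N -> (k * L < N)%N.
Proof.
rewrite leq_divRL// mulSn; apply: leq_trans.
by rewrite -[ltnLHS]add0n ltn_add2r.
Qed.

Lemma prob_nonneg_sample : (0 < N %/ L)%N ->
  (P [set w | forall i, (i < N)%N -> (0 <= phi (y i) w)%R] <=
   ((499 / 500) ^+ (N %/ L))%:E)%E.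
Proof.
move=> m_gt0; set m := (N %/ L)%N in m_gt0 *.
have gz_gt0 k : 0 < Num.sqrt (g (z k) (z k)).
  by rewrite sqrtr_gt0; exact: (green_gt0 deg_gt0 greenN_cvg).
pose Z k w := (Num.sqrt (g (z k) (z k)))^-1 * phi (z k) w.
pose C k l := corr g (z k) (z l).
have mphi x : measurable_fun setT (phi x) by exact: measurable_funP.
have mpos (n : nat) (u : nat -> T) :
    measurable [set w | forall i, (i < n)%N -> 0 <= phi (u i) w].
  rewrite (_ : mkset _ = \bigcap_(k in `I_n) (phi (u k) @^-1` `[0, +oo[)); last first.
    by apply/seteqP; split=> w /= h k kn; have := h k kn; rewrite /= in_itv /= andbT.
  by apply: fin_bigcap_measurable => // k kn; rewrite -[X in measurable X]setTI; apply: mphi.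
have uz : uniq (mkseq z m).
  rewrite map_inj_in_uniq ?iota_uniq// => k l; rewrite !mem_iota /= !add0n => km lm kl.
  apply/eqP; rewrite -(eqn_pmul2r L_gt0) -(nth_uniq (y 0%N) _ _ y_uniq) ?size_mkseq ?zE//.
  by rewrite !nth_mkseq ?zE//; apply/eqP.
have mgf (c : nat -> R) : has_mean P (fun w => expR (\sum_(k < m) c k * Z k w))
    (expR ((\sum_(k < m) \sum_(l < m) c k * c l * C k l) / 2)).
  have := gff_expR gff (fun k => c k / Num.sqrt (g (z k) (z k))) uz.
  congr has_mean.
    apply/funext => w; congr expR; apply: eq_bigr => k _; rewrite /Z; ring.
  congr (expR (_ / 2)); apply: eq_bigr => k _; apply: eq_bigr => l _.
  by rewrite /C /corr -/(g _ _); field; rewrite !gt_eqF.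
have Cdiag k : (k < m)%N -> C k k = 1 by move=> _; exact: corr_refl.
have Csym k l : (k < m)%N -> (l < m)%N -> C k l = C l k by move=> _ _; exact: corr_sym.
have Cr i : (i.+1 < m)%N -> 0 <= C i i.+1 <= (40 * 40)^-1.
  move=> im; have C0 : 0 <= C i i.+1 by exact: corr_ge0.
  have e0 : 0 <= (40 * 40)^-1 :> R by rewrite invr_ge0 mulr_ge0.
  rewrite C0 /= -(@ler_pXn2r _ 2) ?nnegrE//.
  apply: le_trans theta_L; rewrite /C /z mulSn addnC; apply: corr_iter.
  by rewrite addnC -mulSn zE.
have Cm : forall i j, (i.+1 < m)%N -> (j <= i)%N -> C j i.+1 = C i i.+1 * C j i.
  move=> i j im ji; rewrite mulrC; apply: corr_separates => //.
  by apply: y_separates; rewrite ?zE// !leq_mul2r ji leqnSn !orbT.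
have mZ k : (k < m)%N -> measurable_fun setT (Z k).
  by move=> _; apply: measurable_funM.
have := @prob_nonneg_chain R d Omega P m Z C (fun k => C k k.+1) mZ mgf Csym Cdiag Cr Cm m_gt0.
apply: le_trans.
apply: le_measure; rewrite ?inE; first exact: mpos.
  rewrite (_ : mkset _ = [set w | forall k, (k < m)%N -> 0 <= phi (z k) w]); first exact: mpos.
  by apply/seteqP; split=> w /= h k km; have := h k km; rewrite /Z pmulr_rge0 ?invr_gt0.
by move=> w /= h k km; rewrite /Z pmulr_rge0 ?invr_gt0// h// zE.
Qed.

End Sampling.

Lemma deg_gt0_neq (T : rooted_tree) (x y : T) : x != y ->
  forall v : T, (0 < deg v)%N.
Proof.
move=> xy v; have [u uv] : exists u, u != v.
  by have [xv|] := eqVneq x v; [exists y; rewrite -xv eq_sym|exists x].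
have [[|w p] [/= pp lp]] := tree_connected v u; first by rewrite lp eqxx in uv.
by case/andP: pp => vw _; rewrite cardfs_gt0; apply/fset0Pn; exists w.
Qed.

Lemma greenN_cvg_green (R : realType) (T : rooted_tree)
    (dW : measure_display) (W : measurableType dW)
    (Px : T -> probability W R) (X : nat -> W -> T) (x z : T) (c : R) :
    simple_random_walk Px X -> (forall v : T, (0 < deg v)%N) ->
    green Px X x z = c%:E ->
  (fun N => greenN R N x z) @ \oo --> (deg z)%:R * c.
Proof.
move=> srw deg_gt0; rewrite (green_series srw deg_gt0) => gc.
have dz : (deg z)%:R != 0 :> R by rewrite pnatr_eq0 -lt0n.
have Sc : (\sum_(0 <= k <oo) (ptrans R k x z)%:E = ((deg z)%:R * c)%:E)%E.
  by rewrite EFinM -gc muleA -EFinM divff// mul1e.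
have : (fun n => \sum_(0 <= k < n) (ptrans R k x z)%:E)%E @ \oo --> ((deg z)%:R * c)%:E.
  rewrite -Sc; apply: is_cvg_nneseries => n _ _; rewrite lee_fin.
  exact: ptrans_ge0.
move=> /fine_cvg; rewrite (_ : fine \o _ = fun N => greenN R N x z)//.
by apply/funext => n /=; rewrite sumEFin big_mkord.
Qed.

Lemma connected_nonneg_geodesic (R : realType) (T : rooted_tree)
    (d : measure_display) (Omega : measurableType d)
    (P : probability Omega R) (phi : T -> {RV P >-> R}) (x y : T) (p : seq T) :
    geodesic x y p ->
  connected_nonneg phi x y = [set w | forall z, z \in x :: p -> 0 <= phi z w].
Proof.
move=> geo; have [xp lp up] := geodesic_path geo.
apply/seteqP; split=> w /= h; last by exists p.
move: h => [q [xq lq] hq] z zp; apply: hq.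
by apply: (uniq_path_separates xp up zp xq); rewrite lp.
Qed.

Lemma measurable_nonneg_seq (R : realType) (T : rooted_tree)
    (d : measure_display) (Omega : measurableType d)
    (P : probability Omega R) (phi : T -> {RV P >-> R}) (s : seq T) :
  measurable [set w | forall z, z \in s -> 0 <= phi z w].
Proof.
rewrite (_ : mkset _ = \bigcap_(z in [set` s]) (phi z @^-1` `[0, +oo[)); last first.
  by apply/seteqP; split=> w /= h k kn; have := h k kn; rewrite /= in_itv /= andbT.
by apply: fin_bigcap_measurable => // k kn; apply: measurable_funPTI.
Qed.

Section Decay.
Variables (R : realType) (A M : R).
Hypothesis A_gt0 : 0 < A.
Variable L : nat.
Hypothesis L_gt0 : (0 < L)%N.
Hypothesis theta_L : (A / (1 + A)) ^+ L <= (40 * 40)^-1 ^+ 2.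
Variable T : rooted_tree.

Let gd : pred T := fun y => `[< good A M y >].

Lemma sum_good_le (x y : T) (p : seq T) : geodesic x y p ->
  \sum_(z \in oseg x y) (\1_(good A M) z : R) <= (count gd p)%:R.
Proof.
move=> geo; have [_ _ up] := geodesic_path geo.
have sub : oseg x y `<=` [set` p].
  by move=> z [+ zx _]; rewrite (cseg_geodesic geo) /= inE => /predU1P[].
have fin : finite_set (oseg x y) by exact: sub_finite_set sub _.
rewrite fsbig_finite//; apply: (@le_trans _ _ (\sum_(z <- p) (\1_(good A M) z : R))).
  apply: ler_sum_subset; first by move=> z; rewrite indicE.
  - exact: fset_uniq.
  - by move=> z; rewrite in_fset_set// inE => /sub.
rewrite -sum1_count natr_sum [leRHS]big_mkcond /=; apply: ler_sum => z _.
rewrite indicE /gd; case: asboolP => h; first by rewrite mem_set.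
by rewrite memNset.
Qed.

Variables (dW : measure_display) (W : measurableType dW).
Variables (Px : T -> probability W R) (X : nat -> W -> T).
Variables (d : measure_display) (Omega : measurableType d).
Variables (P : probability Omega R) (phi : T -> {RV P >-> R}).
Hypothesis srw : simple_random_walk Px X.
Hypothesis gff : gaussian_free_field phi (green Px X).

Lemma prob_connected_le (x y : T) (p : seq T) : geodesic x y p ->
  (P (connected_nonneg phi x y) <= ((499 / 500) ^+ (count gd p %/ L))%:E)%E.
Proof.
move=> geo; have [xp lp up] := geodesic_path geo.
have [->|] := posnP (count gd p %/ L); first rewrite expr0.
  apply: probability_le1; rewrite (connected_nonneg_geodesic _ geo).
  exact: measurable_nonneg_seq.
set N := count gd p => m_gt0.
have N_gt0 : (0 < N)%N by case: (N) m_gt0 => //; rewrite div0n.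
have deg_gt0 : forall v : T, (0 < deg v)%N.
  have p0 : p != [::] by apply: contraTneq N_gt0 => p0; rewrite /N p0.
  case: (p) p0 up => // u q _ /= /andP[xu _].
  apply: (@deg_gt0_neq T x u); apply: contraNneq xu => ->; exact: mem_head.
have Gcvg (a b : T) := greenN_cvg_green srw deg_gt0 (gff_cov gff a b).1.
pose s := x :: p; pose idx := [seq k <- iota 1 (size p) | gd (nth x s k)].
have isP k : (k < size idx)%N -> [/\ (0 < nth 0%N idx k)%N, (nth 0%N idx k < size s)%N &
    gd (nth x s (nth 0%N idx k))].
  by move=> /(mem_nth 0%N); rewrite mem_filter mem_iota add1n => /and3P[? -> ->].
have size_is : size idx = N.
  rewrite size_filter /N -(count_map (nth x s) gd); congr count.
  rewrite -[RHS](mkseq_nth x) /mkseq -(addn0 1%N) iotaDl -map_comp.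
  by apply: eq_map.
have sis : sorted ltn idx by apply: sorted_filter; [exact: ltn_trans|exact: iota_ltn_sorted].
have is_le i j : (i <= j)%N -> (j < N)%N -> (nth 0%N idx i <= nth 0%N idx j)%N.
  rewrite -size_is => ij jN; have [->//|ne] := eqVneq i j.
  have iN := leq_ltn_trans ij jN; have {ne} ij' : (i < j)%N by rewrite ltn_neqAle ne.
  by apply/ltnW; apply: (sorted_ltn_nth ltn_trans).
have is_lt i : (i.+1 < N)%N -> (nth 0%N idx i < nth 0%N idx i.+1)%N.
  rewrite -size_is => iN; apply: (sorted_ltn_nth ltn_trans) => //; rewrite ?inE//.
  exact: ltnW.
pose z i := nth x s (nth 0%N idx i).
have zu : uniq (mkseq z N).
  rewrite map_inj_in_uniq ?iota_uniq// => i j; rewrite !mem_iota /= !add0n => iN jN.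
  rewrite -size_is in iN jN; have [_ si _] := isP i iN; have [_ sj _] := isP j jN.
  move=> /eqP; rewrite nth_uniq// nth_uniq// => [/eqP//|].
  exact: sorted_uniq ltn_trans ltnn _ sis.
have zs i j k : (i <= j <= k)%N -> (k < N)%N -> separates (z j) (z i) (z k).
  move=> /andP[ij jk] kN; apply: path_separates => //.
    by rewrite !is_le// (leq_ltn_trans jk).
  by rewrite -size_is in kN; have [] := isP k kN.
have zc i : (i.+1 < N)%N ->
    corr (fun a b => fine (green Px X a b)) (z i) (z i.+1) ^+ 2 <= A / (1 + A).
  move=> iN; have lt := is_lt i iN; rewrite -size_is in iN.
  have [k_gt0 ks /asboolP[Rk _]] := isP _ iN.
  rewrite /z; move: (nth 0%N idx i) (nth 0%N idx i.+1) k_gt0 ks Rk lt => j [//|k] _ ks Rk jk.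
  rewrite (corr_separates deg_gt0 Gcvg (y := nth x s k)); last first.
    by apply: path_separates => //; rewrite leqnSn andbT -ltnS.
  rewrite exprMn -[leRHS]mul1r ler_pM ?sqr_ge0//.
    by apply: (sqr_corr_le1 deg_gt0 Gcvg) => a b; rewrite -!(gff_covariance gff) covarianceC.
  apply: (sqr_corr_edge deg_gt0 Gcvg) => //.
  - by move=> a b; rewrite -!(gff_covariance gff) covarianceC.
  - by rewrite tree_sym; exact: (pathP x xp).
  - exact: (green_diag_le deg_gt0 Gcvg).
have := prob_nonneg_sample deg_gt0 gff Gcvg zu zs zc L_gt0 theta_L m_gt0.
apply: le_trans; rewrite (connected_nonneg_geodesic _ geo).
apply: le_measure; rewrite ?inE; first exact: measurable_nonneg_seq.
  rewrite (_ : mkset _ = [set w | forall v, v \in mkseq z N -> 0 <= phi v w]).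
    exact: measurable_nonneg_seq.
  apply/seteqP; split=> w /= h; first by move=> v /mapP[i]; rewrite mem_iota => iN ->; exact: h.
  by move=> i iN; apply: h; apply/mapP; exists i => //; rewrite mem_iota.
move=> w /= h i iN; apply: h; apply: mem_nth; rewrite -size_is in iN.
by have [] := isP i iN.
Qed.

End Decay.

Theorem proposition3p2 (R : realType) (A M delta : R)
    (A_gt0 : 0 < A) (M_gt0 : 0 < M) (delta_gt0 : 0 < delta) :
  exists2 kappa : R, 0 < kappa &
  forall (T : rooted_tree)
    (dW : measure_display) (W : measurableType dW)
    (Px : T -> probability W R) (X : nat -> W -> T)
    (dO : measure_display) (Omega : measurableType dO)
    (PG : probability Omega R) (phi : T -> {RV PG >-> R}),
  simple_random_walk Px X ->
  transient Px X ->
  gaussian_free_field phi (green Px X) ->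
  (\forall n \near \oo, forall x : T, Tinfty x -> height x = n ->
    delta * n%:R <=
      \sum_(y \in oseg (tree_root T) x) (\1_(good A M) y : R)) ->
  \forall n \near \oo, forall x : T, Tinfty x -> height x = n ->
    (PG (connected_nonneg phi (tree_root T) x) <=
      (2 * expR (- kappa * n%:R))%:E)%E.
Proof.
have [L L_gt0 hL] : exists2 L, (0 < L)%N & (A / (1 + A)) ^+ L <= (40 * 40)^-1 ^+ 2.
  have A1 : 0 < 1 + A by rewrite addr_gt0.
  have /cvg_expr th : `|A / (1 + A)| < 1.
    by rewrite ger0_norm ?divr_ge0 ?ltW// ltr_pdivrMr// mul1r ltrDr.
  have e0 : 0 < (40 * 40)^-1 ^+ 2 :> R by rewrite exprn_gt0// invr_gt0 mulr_gt0.
  have [K _ hK] := cvgr_lt _ th _ e0.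
  by exists K.+1 => //; apply/ltW/hK => /=.
have L0 : 0 < L%:R :> R by rewrite ltr0n.
exists (delta / (500 * L%:R)).
  by apply: divr_gt0 delta_gt0 (mulr_gt0 _ L0); exact: ltr0Sn.
move=> T dW W Px X dO Omega PG phi srw _ gff good_near.
near=> n => x xinf xn.
have dn : delta * n%:R <= \sum_(y \in oseg (tree_root T) x) (\1_(good A M) y : R).
  by have := near good_near n; apply.
have [p geo] := geodesic_exists (tree_root T) x.
have hP := prob_connected_le M A_gt0 L_gt0 hL srw gff geo.
apply: (le_trans hP).
set N := count _ p; have dN : delta * n%:R <= N%:R :> R.
  exact: le_trans dn (sum_good_le A M geo).
have NL : N%:R <= (L * (N %/ L).+1)%:R :> R.
  by rewrite ler_nat ltnW// mulnC ltn_ceil.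
set m := (N %/ L)%N in NL *; rewrite lee_fin.
have lam : 499 / 500 <= expR (- 500^-1) :> R.
  by apply: le_trans (expR_ge1Dx _); lra.
have l0 : 0 <= 499 / 500 :> R by apply: divr_ge0; exact: ler0n.
apply: (@le_trans _ _ (expR (- 500^-1) ^+ m)).
  by rewrite lerXn2r ?nnegrE ?expR_ge0.
have e2 : expR 500^-1 <= 2 :> R.
  have := expR_ge1Dx (- 500^-1 : R); have := expRxMexpNx_1 (500^-1 : R).
  have := expR_gt0 (500^-1 : R); move: (expR _) (expR _) => u v u0 uv v1; nra.
rewrite -expRM_natl; apply: (@le_trans _ _ (expR 500^-1 * expR (- (delta / (500 * L%:R)) * n%:R))).
  rewrite -expRD ler_expR.
  have : delta * n%:R / L%:R <= m.+1%:R.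
    by rewrite ler_pdivrMr// -natrM mulnC; exact: le_trans NL.
  rewrite -natr1 (_ : delta / (500 * L%:R) = delta / L%:R / 500); last by field; rewrite gt_eqF.
  rewrite [delta * _ / _]mulrAC; lra.
by rewrite ler_pM2r ?expR_gt0.
Unshelve. all: by end_near. Qed.
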